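(* Every $(\gamma,\lambda)\in\mathcal{N}''$ is isolated in $\mathcal{N}$, i.e., there is an open neighborhood $U\subseteq\mathbb{R}^2$ of $(\gamma,\lambda)$ with $U\cap\mathcal{N}=\{(\gamma,\lambda)\}$.
   Context: $\mathcal{B}=\{1+\sum_{n=1}^{\infty}a_nx^n : a_n\in\{-1,0,1\}\}$, a set of power series converging on $(-1,1)$. $\mathcal{N}=\{(\gamma,\lambda)\in(-1,1)^2:\text{ there exists } f\in\mathcal{B} \text{ with } f(\gamma)=f(\lambda)=0\}$ and $\mathrm{Diag}=\{(\lambda,\lambda):\lambda\in(-1,1)\}$. The set of outlier points is $\mathcal{N}''=\{(\gamma,\lambda)\in\mathcal{N}\setminus\mathrm{Diag} : (\gamma,\lambda)\notin\overline{\mathcal{N}^{\mathrm{o}}}\}$, where $\mathcal{N}^{\mathrm{o}}$ is the interior of $\mathcal{N}$ in $\mathbb{R}^2$ and the bar denotes closure in $\mathbb{R}^2$. *)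

(* Defs.v *)
From HB Require Import structures.
From mathcomp Require Import all_boot all_order all_algebra.
From mathcomp Require Import all_classical all_reals all_analysis.
Import Order.TTheory GRing.Theory Num.Theory.
Import numFieldNormedType.Exports.

Set Implicit Arguments.
Unset Strict Implicit.
Unset Printing Implicit Defensive.

Local Open Scope classical_set_scope.
Local Open Scope ring_scope.

(* A power series is represented by its sequence of coefficients. *)
Definition calB (R : realType) : set (nat -> R) :=
  [set a | a 0%N = 1 /\
    forall n : nat, (0 < n)%N -> a n = -1 \/ a n = 0 \/ a n = 1].

(* [limn] is a junk value when the series diverges; for [a] in [calB] and
   [`|x| < 1] the series converges, by [is_cvg_pseries_calB]. *)
Definition psum (R : realType) (a : nat -> R) (x : R) : R :=
  limn (pseries a x).

Definition calN (R : realType) : set (R * R) :=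
  [set p | [/\ -1 < p.1 < 1, -1 < p.2 < 1 &
    exists2 a, @calB R a & psum a p.1 = 0 /\ psum a p.2 = 0]].

Definition Diag (R : realType) : set (R * R) :=
  [set p | -1 < p.1 < 1 /\ p.1 = p.2].

Definition outlier (R : realType) : set (R * R) :=
  [set p | (@calN R `\` @Diag R) p /\ ~ closure (interior (@calN R)) p].

Arguments calB R : clear implicits.
Arguments calN R : clear implicits.
Arguments Diag R : clear implicits.
Arguments outlier R : clear implicits.

Lemma is_cvg_pseries_calB (R : realType) (a : nat -> R) (x : R) :
  calB R a -> `|x| < 1 -> cvgn (pseries a x).
Proof.
move=> [a0 aS] x1; apply: normed_cvg.
apply: (@series_le_cvg R _ (fun n => `|x| ^+ n)).
- by move=> n; rewrite normr_ge0.
- by move=> n; rewrite exprn_ge0.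
- move=> n; rewrite /= normrM normrX ler_piMl ?exprn_ge0//.
  case: n => [|n]; first by rewrite a0 normr1.
  by case: (aS n.+1 isT) => [->|[->|->]]; rewrite ?normrN ?normr1 ?normr0.
- have := @is_cvg_geometric_series R 1 `|x|; rewrite normr_id => /(_ x1).
  rewrite (_ : geometric 1 `|x| = (fun n => `|x| ^+ n))//.
  by apply/funext => n; rewrite /= mul1r.
Qed.

(* Main.v *)
Require Import Defs.
From HB Require Import structures.
From mathcomp Require Import all_boot all_order all_algebra.
From mathcomp Require Import all_classical all_reals all_analysis.
From mathcomp Require Import zify ring lra.
Import Order.TTheory GRing.Theory Num.Theory.
Import numFieldNormedType.Exports.

(* For digits in {0, 1}, let A be the attractor of the two maps z -> T z and
   z -> T z + (1, 1), where T = diag (gamma, lambda). A series f in B vanishing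
   at gamma and lambda gives two addresses of one point of A, so A is connected
   along chains of digit sequences, and a series with prefix p_n has a common
   zero near (gamma, lambda) exactly when T^-n p_n (T) lies in A - A.

   If f changes sign at both zeros, T^-n p_n (T) sweeps out large squares near
   (gamma, lambda), so it is enough that A - A contains a ball in a stable way.
   Take two chains in A whose end-to-end vectors a, b are independent. The
   translates of the boundary of their difference by the lattice Za + Zb wind
   once around every point, so the winding parity is odd around some point off
   the boundary, because A has measure zero when |gamma lambda| < 1/2. Parity is
   stable, and an odd parity forces two chains to cross, which produces a series
   with smaller values; iterating gives a common zero. Hence such pairs lie in
   the closure of the interior of N. Pairs with |gamma lambda| > 1/2 are interior
   points by the pigeonhole principle.

   At an outlier, f therefore does not change sign at one of the zeros, say
   gamma, and Jensen's inequality excludes this for both zeros. Moving one far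
   digit would create a sign change unless the tail of f is extremal at gamma;
   then every series close to f is at least f near gamma, which excludes other
   zeros nearby. *)

Set Implicit Arguments.
Unset Strict Implicit.
Unset Printing Implicit Defensive.

Local Open Scope classical_set_scope.
Local Open Scope ring_scope.

(** * Power series with bounded coefficients *)

Section PowerSeries.
Variable R : realType.
Implicit Types (a b : nat -> R) (x z M : R).

Definition coef_le M a := forall n, `|a n| <= M.

Lemma coef_le_ge0 M a : coef_le M a -> 0 <= M.
Proof. by move=> /(_ 0%N); apply: le_trans. Qed.

Lemma coef_le_shift M a k : coef_le M a -> coef_le M (fun n => a (k + n)%N).
Proof. by move=> h n; apply: h. Qed.

Lemma psum_normed_cvg M a x : coef_le M a -> `|x| < 1 ->
  cvgn [normed pseries a x].
Proof.
move=> aM x1; apply: (@series_le_cvg R _ (fun n => M * `|x| ^+ n)).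
- by move=> n; rewrite normr_ge0.
- by move=> n; rewrite mulr_ge0 ?exprn_ge0 ?(coef_le_ge0 aM).
- by move=> n; rewrite /= normrM normrX ler_wpM2r ?exprn_ge0.
- by have := @is_cvg_geometric_series R M `|x|; rewrite normr_id => /(_ x1).
Qed.

Lemma psum_is_cvg M a x : coef_le M a -> `|x| < 1 -> cvgn (pseries a x).
Proof. by move=> aM x1; apply: normed_cvg; exact: psum_normed_cvg aM x1. Qed.

Lemma psum_cvg M a x : coef_le M a -> `|x| < 1 ->
  pseries a x @ \oo --> psum a x.
Proof. by move=> aM x1; exact: psum_is_cvg aM x1. Qed.

Lemma psum_le M a x : coef_le M a -> `|x| < 1 -> `|psum a x| <= M / (1 - `|x|).
Proof.
move=> aM x1; apply: (le_trans (lim_series_norm (psum_normed_cvg aM x1))).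
have cg := @cvg_geometric_series R M `|x|; rewrite normr_id in cg.
rewrite -(cvg_lim (@Rhausdorff R) (cg x1)).
apply: lim_series_le; first exact: psum_normed_cvg aM x1.
  exact: cvgP (cg x1).
by move=> n; rewrite /= normrM normrX ler_wpM2r ?exprn_ge0.
Qed.

Lemma psumB M N a b x : coef_le M a -> coef_le N b -> `|x| < 1 ->
  psum (fun n => a n - b n) x = psum a x - psum b x.
Proof.
move=> aM bN x1; rewrite /psum /pseries -lim_seriesB; first last.
- exact: psum_is_cvg bN x1.
- exact: psum_is_cvg aM x1.
congr (limn (series _)); apply/funext => n.
by rewrite /= mulrBl.
Qed.

Lemma psumZ M c a x : coef_le M a -> `|x| < 1 ->
  psum (fun n => c * a n) x = c * psum a x.
Proof.
move=> aM x1; rewrite /psum /pseries -[RHS]lim_seriesZ; last first.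
  exact: psum_is_cvg aM x1.
congr (limn (series _)); apply/funext => n.
by rewrite /= -mulrA.
Qed.

Lemma psum_shift M a x : coef_le M a -> `|x| < 1 ->
  psum a x = a 0%N + x * psum (fun n => a n.+1) x.
Proof.
move=> aM x1; apply: cvg_lim => //.
rewrite -cvg_shiftS /=.
have -> : (fun n => pseries a x n.+1) =
    (fun n => a 0%N + x * pseries (fun n => a n.+1) x n).
  apply/funext => n; rewrite /pseries /series/= big_nat_recl//= expr0 mulr1.
  congr (_ + _); rewrite mulr_sumr; apply: eq_bigr => i _.
  by rewrite exprS mulrCA.
apply: cvgD; first exact: cvg_cst.
apply: cvgM; first exact: cvg_cst.
apply: (@psum_cvg M) => // n; exact: aM.
Qed.

Lemma psum_split M a x n : coef_le M a -> `|x| < 1 ->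
  psum a x = \sum_(i < n) a i * x ^+ i + x ^+ n * psum (fun k => a (n + k)%N) x.
Proof.
move=> aM x1; elim: n => [|n IH].
  by rewrite big_ord0 add0r expr0 mul1r.
rewrite IH big_ord_recr /= -addrA; congr (_ + _).
rewrite (psum_shift (coef_le_shift n aM))// addn0 mulrDr mulrC; congr (_ + _).
rewrite exprSr mulrA; congr (_ * psum _ _).
by apply/funext => k; congr a; lia.
Qed.

(** Synthetic division: the coefficients of the quotient of [psum a x - psum a z] by [x - z]. *)
Definition divX z a : nat -> R := fun n => psum (fun k => a (n.+1 + k)%N) z.

Lemma coef_le_divX M a z : coef_le M a -> `|z| < 1 ->
  coef_le (M / (1 - `|z|)) (divX z a).
Proof. by move=> aM z1 n; apply: psum_le. Qed.

Lemma divXS M a z n : coef_le M a -> `|z| < 1 ->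
  divX z a n = a n.+1 + z * divX z a n.+1.
Proof.
move=> aM z1; rewrite {1}/divX (psum_shift (coef_le_shift _ aM))// addn0.
congr (_ + _ * psum _ _); apply/funext => k.
by congr a; lia.
Qed.

Lemma psum_divX0 M a z : coef_le M a -> `|z| < 1 ->
  psum a z = a 0%N + z * divX z a 0%N.
Proof. by move=> aM z1; rewrite (psum_shift aM z1). Qed.

Lemma psum_divX M a x z : coef_le M a -> `|x| < 1 -> `|z| < 1 ->
  psum a x - psum a z = (x - z) * psum (divX z a) x.
Proof.
move=> aM x1 z1; have hM := coef_le_divX aM z1.
have hS := coef_le_shift 1%N hM; have aS := coef_le_shift 1%N aM.
have E1 : psum (fun n => a n.+1) x =
    psum (divX z a) x - z * psum (fun n => divX z a n.+1) x.
  rewrite -(psumZ z hS)// -(psumB hM (N := `|z| * (M / (1 - `|z|))))//; last first.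
    by move=> n; rewrite normrM ler_wpM2l// hS.
  by congr psum; apply/funext => n; rewrite (divXS n aM z1) addrK.
have E2 := psum_shift hM x1.
rewrite (psum_shift aM x1) (psum_divX0 aM z1) E1.
rewrite {2}E2 in E1 *.
rewrite {1}E2; ring.
Qed.

(** Dividing by [x - z] costs one factor [(1 - r)^-1] in the coefficient bound, and evaluating the
    quotient costs a second one. *)
Lemma psum_lip M a x z r : coef_le M a -> r < 1 -> `|x| <= r -> `|z| <= r ->
  `|psum a x - psum a z| <= `|x - z| * (M / (1 - r) ^+ 2).
Proof.
move=> aM r1 xr zr.
have x1 := le_lt_trans xr r1; have z1 := le_lt_trans zr r1.
rewrite (psum_divX aM)// normrM ler_wpM2l//.
apply: le_trans (psum_le (coef_le_divX aM z1) x1) _.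
rewrite -mulrA -invfM expr2 ler_wpM2l ?(coef_le_ge0 aM)//.
rewrite lef_pV2 ?posrE ?mulr_gt0 ?subr_gt0//.
by apply: ler_pM; lra.
Qed.

Lemma psum_continuous M a x : coef_le M a -> `|x| < 1 ->
  {for x, continuous (psum a)}.
Proof.
move=> aM x1; set r := (1 + `|x|) / 2.
have r1 : r < 1 by rewrite /r; lra.
have xr : `|x| < r by rewrite /r; lra.
set C := M / (1 - r) ^+ 2.
have C0 : 0 <= C by rewrite /C divr_ge0 ?(coef_le_ge0 aM)// exprn_ge0// subr_ge0 ltW.
apply/cvgrPdist_le => e e0.
near=> y.
have yr : `|y| <= r.
  near: y; apply: (cvgr_norm_le _ (cvg_id : y @[y --> x] --> x)); exact: xr.
apply: le_trans (psum_lip aM r1 (ltW xr) yr) _.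
have : `|x - y| <= e / (C + 1).
  near: y; apply: cvgr_dist_le; first exact: cvg_id.
  by rewrite divr_gt0// ltr_wpDl.
rewrite ler_pdivlMr ?ltr_wpDl//; apply: le_trans.
by rewrite ler_wpM2l// lerDl.
Unshelve. all: by end_near. Qed.

End PowerSeries.

(** * Binary words and coefficient sequences *)

Section Words.
Variable R : realType.
Implicit Types (a : nat -> R) (x y z : nat -> bool) (t : R) (T : R * R).

Lemma expr_small t e : `|t| < 1 -> 0 < e ->
  exists N, forall n, (N <= n)%N -> `|t| ^+ n < e.
Proof.
move=> t1 e0; have := @cvg_expr R t t1.
move=> /cvgrPdist_lt/(_ e e0)[N _ HN]; exists N => n Nn.
by have := HN n Nn; rewrite sub0r normrN normrX.
Qed.

Lemma calB_le a : calB R a -> coef_le 1 a.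
Proof.
move=> [a0 aS] [|n]; first by rewrite a0 normr1.
by case: (aS n.+1 isT) => [->|[->|->]]; rewrite ?normrN ?normr1 ?normr0.
Qed.

Lemma calB_digit a n : calB R a -> a n = -1 \/ a n = 0 \/ a n = 1.
Proof. by move=> [a0 aS]; case: n => [|n]; [right; right|exact: aS]. Qed.

Definition agree U n (x y : nat -> U) := forall i, (i < n)%N -> x i = y i.

Lemma calB_zero_neq0 f t : calB R f -> `|t| < 1 -> psum f t = 0 -> t != 0.
Proof.
move=> Bf t1 ft; apply/eqP => t0; move: ft.
rewrite t0 (psum_shift (calB_le Bf)) ?normr0// mul0r addr0.
by case: Bf => -> _ /eqP; rewrite oner_eq0.
Qed.

(* Compactness of the set of coefficient sequences. *)
Lemma calB_konig (Q : nat -> set (nat -> R)) :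
    (forall k a, Q k.+1 a -> Q k a) ->
    (forall k, exists2 a, calB R a & Q k a) ->
  exists2 a, calB R a & forall n k,
    exists2 b, calB R b & Q k b /\ agree n a b.
Proof.
move=> Qanti Qex.
have Qle k k' a : (k <= k')%N -> Q k' a -> Q k a.
  move=> /subnK <-; elim: (k' - k)%N => // d IH; rewrite addSn.
  by move=> /Qanti.
pose good (s : seq R) := forall k, exists2 b, calB R b &
  Q k b /\ agree (size s) (nth 0 s) b.
have step (u : {s | good s}) :
    {v : {s | good s} | exists c, projT1 v = rcons (projT1 u) c}.
  apply: cid; case: u => s gs /=.
  suff [c gc] : exists c, good (rcons s c) by exists (exist _ _ gc); exists c.
  apply: contrapT => /forallNP nog.
  have bad c : exists k, forall b, calB R b -> Q k b ->
      agree (size s) (nth 0 s) b -> b (size s) <> c.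
    have /existsNP[k hk] := nog c; exists k => b Bb Qb sb bc.
    apply: hk; exists b => //; split => // i; rewrite size_rcons ltnS leq_eqVlt.
    rewrite nth_rcons => /orP[/eqP->|h]; first by rewrite ltnn eqxx.
    by rewrite h sb.
  (* If each of the three digits failed at some level, the largest of these levels would exclude all
     of them, because [Q] is decreasing; yet [s] extends into it. *)
  have [k1 h1] := bad (-1); have [k2 h2] := bad 0; have [k3 h3] := bad 1.
  have [b Bb [Qb sb]] := gs (maxn k1 (maxn k2 k3)).
  case: (calB_digit (size s) Bb) => [|[]].
  - by apply: h1 => //; apply: Qle Qb; lia.
  - by apply: h2 => //; apply: Qle Qb; lia.
  - by apply: h3 => //; apply: Qle Qb; lia.
have good0 : good [::].
  by move=> k; have [b Bb Qb] := Qex k; exists b => //; split.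
have [f [f0 fS]] := dependent_choice step (exist _ _ good0).
pose s n := projT1 (f n).
have sz n : size (s n) = n.
  elim: n => [|n IH]; first by rewrite /s f0.
  by have [c e] := fS n; rewrite /s e size_rcons -/(s n) IH.
have pre m n : (m <= n)%N -> forall i, (i < m)%N -> nth 0 (s n) i = nth 0 (s m) i.
  move=> /subnK <-; elim: (n - m)%N => // d IH i im.
  have [c e] := fS (d + m)%N; rewrite addSn {1}/s e -/(s _) nth_rcons sz.
  by rewrite ifT ?IH//; lia.
pose a i := nth 0 (s i.+1) i.
have aE n i : (i < n)%N -> nth 0 (s n) i = a i by move=> h; exact: (pre i.+1 n).
have gd n k : exists2 b, calB R b & Q k b /\ agree n a b.
  have [b Bb [Qb sb]] := projT2 (f n) k; exists b => //; split => // i ni.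
  by rewrite -(aE n)// sb//= -/(s n) sz.
exists a => //; split.
  by have [b [b0 _] [_ ab]] := gd 1%N 0%N; rewrite ab.
move=> n n0; have [b Bb [_ ab]] := gd n.+1 0%N.
by rewrite ab//; exact: calB_digit.
Qed.

Lemma psum_agree a b t n M N : coef_le M a -> coef_le N b -> `|t| < 1 -> agree n a b ->
  `|psum a t - psum b t| <= `|t| ^+ n * ((M + N) / (1 - `|t|)).
Proof.
move=> aM bN t1 ab; rewrite -(psumB aM bN)//.
have dM : coef_le (M + N) (fun n => a n - b n).
  by move=> i; apply: le_trans (ler_normB _ _) _; apply: lerD.
rewrite (psum_split n dM)// big1 ?add0r; last first.
  by move=> i _; rewrite ab// subrr mul0r.
rewrite normrM normrX ler_wpM2l ?exprn_ge0//.
by apply: psum_le => //; exact: (coef_le_shift n dM).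
Qed.

Definition scons (c : bool) x : nat -> bool := fun n => if n is k.+1 then x k else c.
Definition stail x : nat -> bool := fun n => x n.+1.

Lemma scons_tail x : scons (x 0%N) (stail x) = x.
Proof. by apply/funext => -[]. Qed.

Definition val t x : R := psum (fun i => (x i)%:R) t.

Lemma word_coef_le x : coef_le 1 (fun i => (x i)%:R : R).
Proof. by move=> n; case: (x n); rewrite ?normr1 ?normr0. Qed.

Lemma word_diff_coef_le x y : coef_le 1 (fun i => (x i)%:R - (y i)%:R : R).
Proof. by move=> n; case: (x n); case: (y n); rewrite ?subrr ?subr0 ?sub0r ?normrN ?normr1 ?normr0. Qed.

Lemma val_cons t c x : `|t| < 1 -> val t (scons c x) = c%:R + t * val t x.
Proof. by move=> t1; rewrite /val (psum_shift (word_coef_le _)). Qed.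

Lemma val_diff t x y : `|t| < 1 ->
  val t x - val t y = psum (fun i => (x i)%:R - (y i)%:R) t.
Proof. by move=> t1; rewrite (psumB (@word_coef_le _) (@word_coef_le _)). Qed.

Lemma val_agree t r n x y : `|t| <= r -> r < 1 -> agree n x y ->
  `|val t x - val t y| <= r ^+ n / (1 - r).
Proof.
move=> tr r1 xy; have t1 := le_lt_trans tr r1.
rewrite val_diff// (psum_split n (@word_diff_coef_le x y))// big1 ?add0r; last first.
  by move=> i _; rewrite xy// subrr mul0r.
rewrite normrM normrX; apply: ler_pM => //.
  by rewrite lerXn2r ?nnegrE// (le_trans _ tr).
apply: le_trans (psum_le (coef_le_shift n (@word_diff_coef_le x y)) t1) _.
by rewrite div1r lef_pV2 ?posrE; lra.
Qed.

Lemma val_lip t u r x : r < 1 -> `|t| <= r -> `|u| <= r ->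
  `|val t x - val u x| <= `|t - u| / (1 - r) ^+ 2.
Proof.
by move=> r1 tr ur; have := psum_lip (word_coef_le x) r1 tr ur; rewrite mul1r.
Qed.

(** Past the common prefix the difference starts with [1] or [-1]; the sign [s] normalises it, and
    the prefix only contributes the power of [t]. *)
Lemma calB_of_diff x y j : x j <> y j -> agree j x y ->
  exists2 a, calB R a &
    forall t, `|t| < 1 -> `|val t x - val t y| = `|t| ^+ j * `|psum a t|.
Proof.
move=> xyj xy; pose s : R := if x j then 1 else -1.
have dM := @word_diff_coef_le x y.
exists (fun i => s * ((x (j + i)%N)%:R - (y (j + i)%N)%:R)).
  split => [|n _]; rewrite /s.
    rewrite addn0; move: xyj; case: (x j); case: (y j) => //= _;
    by rewrite ?subr0 ?sub0r ?mulrNN ?mulr1.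
  case: (x j); case: (x (j + n)%N); case: (y (j + n)%N) => /=;
    rewrite ?subrr ?subr0 ?sub0r ?mulrNN ?mulr1 ?mulr0 ?mulN1r ?mul1r ?oppr0; tauto.
move=> t t1; rewrite val_diff// (psum_split j dM)// big1 ?add0r; last first.
  by move=> i _; rewrite xy// subrr mul0r.
rewrite normrM normrX; congr (_ * _).
rewrite (psumZ s (coef_le_shift j dM))// normrM.
by rewrite /s; case: (x j); rewrite ?normrN normr1 mul1r.
Qed.

End Words.

(** * Pairs with product above one half *)

Section CommonZero.
Variable R : realType.
Implicit Types (a b : nat -> R) (t g l e : R).

Lemma le0_of_small (u : R) : (forall e : R, 0 < e -> u <= e) -> u <= 0.
Proof.
move=> h; rewrite leNgt; apply/negP => u0.
by have := h (u / 2); rewrite divr_gt0// => /(_ isT); lra.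
Qed.

(** Compactness: better and better approximate solutions share longer and longer prefixes with a
    limit series, whose values are then arbitrarily small. *)
Lemma calB_zero_of_small g l : `|g| < 1 -> `|l| < 1 ->
    (forall e : R, 0 < e -> exists2 a, calB R a & `|psum a g| <= e /\ `|psum a l| <= e) ->
  calN R (g, l).
Proof.
move=> g1 l1 small; split; rewrite -?ltr_norml//=.
pose Q k := [set a : nat -> R | `|psum a g| <= k.+1%:R^-1 /\ `|psum a l| <= k.+1%:R^-1].
have Qanti k a : Q k.+1 a -> Q k a.
  have le : (k.+2%:R^-1 : R) <= k.+1%:R^-1 by rewrite lef_pV2 ?posrE// ler_nat.
  by move=> [h1 h2]; split; apply: le_trans le.
have Qex k : exists2 a, calB R a & Q k a by apply: small; rewrite invr_gt0.
have [a Ba ha] := calB_konig Qanti Qex.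
exists a => //; suff vanish t : `|t| < 1 -> (forall k b, Q k b -> `|psum b t| <= k.+1%:R^-1) -> psum a t = 0.
  by split; apply: vanish => // k b [].
move=> t1 Qt; apply/eqP; rewrite -normr_le0; apply: le0_of_small => e e0.
have C0 : 0 < (1 + 1) / (1 - `|t|) :> R by rewrite divr_gt0 ?subr_gt0.
have [N hN] := @expr_small _ t (e / 2 / ((1 + 1) / (1 - `|t|))) t1 (divr_gt0 (divr_gt0 e0 (ltr0Sn _ _)) C0).
have [k hk] : exists k, (k.+1%:R^-1 : R) <= e / 2.
  exists (Num.truncn (e / 2)^-1); rewrite invf_ple ?posrE ?divr_gt0//.
  exact/ltW/truncnS_gt.
have [b Bb [Qb ab]] := ha N k.
have := psum_agree (calB_le Ba) (calB_le Bb) t1 ab.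
have := hN N (leqnn _); rewrite ltr_pdivlMr// => h1 h2.
have h3 := le_trans (Qt _ _ Qb) hk.
have h4 := le_lt_trans h2 h1.
have := ler_normD (psum a t - psum b t) (psum b t); rewrite subrK.
by move: h3 h4; clear; lra.
Qed.

Lemma expr_large (q C : R) : 1 < q -> exists n, C < q ^+ n.
Proof.
move=> q1; have q0 : 0 < q := lt_trans ltr01 q1.
have [C0|C0] := leP C 0; first by exists 0%N; rewrite expr0; lra.
have [||N hN] := @expr_small _ q^-1 C^-1.
- by rewrite normfV gtr0_norm// invf_lt1.
- by rewrite invr_gt0.
have := hN N (leqnn _).
rewrite normfV (gtr0_norm q0) exprVn ltf_pV2 ?posrE ?exprn_gt0//.
by exists N.
Qed.

(* Among the [2 ^ n] words of length [n], two have values in the same cell of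
   a grid with mesh [e * `|t| ^ n]; the first index at which they differ is at
   most [n], so dividing by its power of [t] leaves a difference of at most
   [e]. *)
Lemma pigeonhole_small g l e : `|g| < 1 -> `|l| < 1 -> 2^-1 < `|g * l| -> 0 < e ->
  exists2 a, calB R a & `|psum a g| <= e /\ `|psum a l| <= e.
Proof.
move=> g1 l1 gl e0.
have g0 : 0 < `|g|.
  by rewrite normr_gt0; apply: contraTneq gl => ->; rewrite mul0r normr0; lra.
have l0 : 0 < `|l|.
  by rewrite normr_gt0; apply: contraTneq gl => ->; rewrite mulr0 normr0; lra.
pose C t := (1 - `|t|)^-1 : R.
have C0 t : `|t| < 1 -> 0 < C t by move=> t1; rewrite invr_gt0 subr_gt0.
have Cle t x : `|t| < 1 -> `|val t x| <= C t.
  by move=> t1; apply: le_trans (psum_le (@word_coef_le R x) t1) _; rewrite div1r.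
pose D t := 2 * C t / e + 1.
have D1 t : `|t| < 1 -> 1 < D t.
  by move=> t1; rewrite ltrDr divr_gt0// mulr_gt0// C0.
(* In each coordinate the number of cells is at most [D t] over the [n]-th power of the modulus of
   [t], so this [n] gives more words than pairs of cells. *)
have [n hn] : exists n, D g * D l < (2 * `|g * l|) ^+ n.
  by apply: expr_large; rewrite -ltr_pdivrMl// mulr1.
pose cell t x := Num.truncn ((val t x + C t) / (e * `|t| ^+ n)).
pose K t := Num.truncn (2 * C t / (e * `|t| ^+ n)).
have den t : 0 < `|t| -> 0 < e * `|t| ^+ n by move=> t0; rewrite mulr_gt0 ?exprn_gt0.
have arg0 t x : `|t| < 1 -> 0 < `|t| -> 0 <= (val t x + C t) / (e * `|t| ^+ n).
  move=> t1 t0; apply: divr_ge0; last exact/ltW/den.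
  by have := Cle t x t1; rewrite ler_norml => /andP[]; lra.
have cellK t x : `|t| < 1 -> 0 < `|t| -> (cell t x < (K t).+1)%N.
  move=> t1 t0; rewrite ltnS; apply: le_truncn.
  rewrite ler_wpM2r ?invr_ge0 ?(ltW (den t t0))//.
  by have := Cle t x t1; rewrite ler_norml => /andP[]; lra.
have KD t : `|t| < 1 -> 0 < `|t| -> (K t).+1%:R <= D t / `|t| ^+ n.
  move=> t1 t0; have pt : 0 < `|t| ^+ n by rewrite exprn_gt0.
  have pt1 : `|t| ^+ n <= 1 by rewrite exprn_ile1// ltW.
  have : (K t)%:R <= 2 * C t / (e * `|t| ^+ n).
    by rewrite truncn_le divr_ge0// ?(ltW (den t t0))// mulr_ge0 ?ltW ?C0.
  rewrite invfM mulrA -[(K t).+1%:R]natr1 (_ : D t / _ = 2 * C t / e / `|t| ^+ n + 1 / `|t| ^+ n); last by rewrite -mulrDl.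
  rewrite div1r => h.
  by apply: lerD => //; rewrite invf_ge1.
have same t x y : `|t| < 1 -> 0 < `|t| -> cell t x = cell t y ->
    `|val t x - val t y| <= e * `|t| ^+ n.
  move=> t1 t0 xy; have dt := den t t0.
  have /andP[x1 x2] := truncn_itv (arg0 t x t1 t0).
  have /andP[y1 y2] := truncn_itv (arg0 t y t1 t0).
  rewrite -!/(cell t _) xy -natr1 in x1 x2 y1 y2.
  have : `|(val t x + C t) / (e * `|t| ^+ n) - (val t y + C t) / (e * `|t| ^+ n)| <= 1.
    by rewrite ler_norml; apply/andP; split; lra.
  rewrite -mulrBl normrM normfV (gtr0_norm dt) ler_pdivrMr// mul1r.
  by rewrite opprD addrACA subrr addr0.
pose word (w : n.-tuple bool) : nat -> bool := nth false w.
pose code w : 'I_(K g).+1 * 'I_(K l).+1 :=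
  (Ordinal (cellK g (word w) g1 g0), Ordinal (cellK l (word w) l1 l0)).
have [w [w' [ww' cw]]] : exists w w', w <> w' /\ code w = code w'.
  apply: contrapT => h.
  have inj : injective code.
    by move=> w w' ww'; apply: contrapT => ne; apply: h; exists w, w'.
  have := leq_card code inj.
  rewrite card_prod !card_ord card_tuple card_bool.
  rewrite -(ler_nat R) natrM natrX; apply/negP; rewrite -ltNge.
  apply: le_lt_trans (ler_pM _ _ (KD g g1 g0) (KD l l1 l0)) _ => //.
  rewrite mulrACA -invfM -exprMn -normrM.
  rewrite ltr_pdivrMr -?exprMn ?exprn_gt0// normrM mulr_gt0//.
have c1 : cell g (word w) = cell g (word w') :=
  congr1 (fun p : 'I_(K g).+1 * 'I_(K l).+1 => nat_of_ord p.1) cw.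
have c2 : cell l (word w) = cell l (word w') :=
  congr1 (fun p : 'I_(K g).+1 * 'I_(K l).+1 => nat_of_ord p.2) cw.
have exj : exists j, word w j != word w' j.
  apply: contrapT => /forallNP h; apply: ww'; apply: val_inj => /=.
  apply: (@eq_from_nth _ false); first by rewrite !size_tuple.
  by move=> i _; apply/eqP; have := h i; move/negP; rewrite negbK.
case: (ex_minnP exj) => j /eqP hj jmin.
have jn : (j <= n)%N.
  rewrite leqNgt; apply/negP => nj; apply: hj.
  have out (v : n.-tuple bool) : word v j = false.
    by apply: nth_default; rewrite size_tuple ltnW.
  by rewrite !out.
have [|a Ba ha] := @calB_of_diff R _ _ _ hj.
  move=> i ij; apply/eqP; apply: contraTT ij => /jmin; by rewrite -leqNgt.
exists a => //; suff fin t : `|t| < 1 -> 0 < `|t| -> cell t (word w) = cell t (word w') ->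
  `|psum a t| <= e by split; apply: fin.
move=> t1 t0 /(same _ _ _ t1 t0); rewrite (ha t t1).
have pj : 0 < `|t| ^+ j by rewrite exprn_gt0.
rewrite -ler_pdivlMl// mulrCA => /le_trans; apply.
apply: ler_piMr; first exact: ltW.
rewrite -(subnKC jn) exprD.
by rewrite mulKf ?gt_eqF// exprn_ile1// ltW.
Qed.

Lemma calN_of_prod_gt_half g l : `|g| < 1 -> `|l| < 1 -> 2^-1 < `|g * l| ->
  calN R (g, l).
Proof.
by move=> g1 l1 gl; apply: calB_zero_of_small => // e; exact: pigeonhole_small.
Qed.

Lemma nbhs_pair_ball (P : R * R) (A : set (R * R)) :
  nbhs P A <-> exists2 e : R, 0 < e &
    forall Q : R * R, `|P.1 - Q.1| < e -> `|P.2 - Q.2| < e -> A Q.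
Proof.
split.
  move=> /nbhs_ballP[e e0 eA]; exists e => // Q h1 h2.
  by apply: eA; split.
move=> [e e0 eA]; apply/nbhs_ballP; exists e => // Q [h1 h2].
exact: eA.
Qed.

(** Pairs whose product has modulus above one half form an open subset of [calN]. When the modulus
    is exactly one half, stretching the first coordinate slightly enters this set, so the pair is
    still in the closure of the interior. *)
Lemma outlier_prod_lt_half g l : outlier R (g, l) -> `|g * l| < 2^-1.
Proof.
move=> [[[/= g1 l1 _] _] ncl]; rewrite ltNge; apply/negP => half; apply: ncl.
have {}g1 : `|g| < 1 by rewrite ltr_norml.
have {}l1 : `|l| < 1 by rewrite ltr_norml.
have g0 : 0 < `|g|.
  by rewrite normr_gt0; apply: contraTneq half => ->; rewrite mul0r normr0; lra.
have l0 : 0 < `|l|.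
  by rewrite normr_gt0; apply: contraTneq half => ->; rewrite mulr0 normr0; lra.
move=> A /nbhs_pair_ball[e e0 eA].
(* The first bound moves [g] by less than [e]; the second keeps [q * g] in the unit interval. *)
pose q : R := Num.min (1 + e / 2) ((1 + `|g|^-1) / 2).
have gi : 1 < `|g|^-1 by rewrite invf_gt1.
have q1 : 1 < q by rewrite lt_min; apply/andP; split; lra.
have qe : q <= 1 + e / 2 by rewrite ge_min lexx.
have qg : q * `|g| < 1.
  rewrite -ltr_pdivlMr// div1r; apply: le_lt_trans (_ : (1 + `|g|^-1) / 2 < _); last lra.
  by rewrite ge_min lexx orbT.
exists (q * g, l); split; last first.
  apply: eA => /=; last by rewrite subrr normr0.
  rewrite (_ : g - q * g = - ((q - 1) * g)); last by ring.
  rewrite normrN normrM ger0_norm; last lra.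
  apply: (@le_lt_trans _ _ (q - 1)); last lra.
  by rewrite ler_piMr ?(ltW g1)//; lra.
suff : \forall P \near (q * g, l), calN R P by [].
have U : open [set P : R * R | `|P.1| < 1 /\ `|P.2| < 1 /\ 2^-1 < `|P.1 * P.2| ].
  have c1 : continuous (fun P : R * R => P.1) by move=> ?; exact: cvg_fst.
  have c2 : continuous (fun P : R * R => P.2) by move=> ?; exact: cvg_snd.
  have cn (f : R * R -> R) : continuous f -> continuous (fun P => `|f P|).
    by move=> cf P; apply: cvg_norm; exact: cf.
  apply: openI; last apply: openI.
  - by apply: (open_comp _ (@open_lt R 1)) => P _; exact: cn.
  - by apply: (open_comp _ (@open_lt R 1)) => P _; exact: cn.
  - apply: (open_comp _ (@open_gt R 2^-1)) => P _; apply: cn => {}P.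
    by apply: cvgM; [exact: c1|exact: c2].
apply: filterS (open_nbhs_nbhs (conj U _)).
  by move=> [x y] /= [x1 [y1 xy]]; exact: calN_of_prod_gt_half.
rewrite /= normrM ger0_norm; last lra.
split => //; split => //; rewrite -mulrA normrM ger0_norm; last lra.
apply: le_lt_trans half _; rewrite ltr_pMl//.
by rewrite normrM mulr_gt0.
Qed.

End CommonZero.

(** * Jensen bound and sign changes *)

Section Jensen.
Variable R : realType.
Implicit Types (a f h : nat -> R) (r t x z M B : R) (zs : seq R).

(** On coefficient sequences [prev], [mulX] and [mulXr] multiply by [X], by [X - z] and by
    [1 - z X]. *)
Definition prev h : nat -> R := fun n => if n is k.+1 then h k else 0.
Definition mulX z h : nat -> R := fun n => prev h n - z * h n.
Definition mulXr z h : nat -> R := fun n => h n - z * prev h n.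
Definition mulXs zs h : nat -> R := foldr mulX h zs.

Lemma mulXsE z zs h : mulXs (z :: zs) h = mulX z (mulXs zs h). Proof. by []. Qed.

Lemma mulX_mulXr z t h : mulXr z (mulX t h) = mulX t (mulXr z h).
Proof. by apply/funext => -[|[|n]]; rewrite /mulX /mulXr/=; ring. Qed.

Lemma mulXs_mulXr z zs h : mulXr z (mulXs zs h) = mulXs zs (mulXr z h).
Proof. by elim: zs => //= t zs IH; rewrite mulX_mulXr IH. Qed.

Lemma cvg_prev0 h : h @ \oo --> 0 -> prev h @ \oo --> 0.
Proof. by move=> h0; rewrite -cvg_shiftS. Qed.

Lemma cvg_mulX0 z h : h @ \oo --> 0 -> mulX z h @ \oo --> 0.
Proof.
move=> h0; rewrite -[X in _ --> X](_ : 0 - z * 0 = 0); last by ring.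
by apply: cvgB; [exact: cvg_prev0|apply: cvgM => //; exact: cvg_cst].
Qed.

Lemma cvg_mulXr0 z h : h @ \oo --> 0 -> mulXr z h @ \oo --> 0.
Proof.
move=> h0; rewrite -[X in _ --> X](_ : 0 - z * 0 = 0); last by ring.
by apply: cvgB => //; apply: cvgM; [exact: cvg_cst|exact: cvg_prev0].
Qed.

Lemma cvg_mulXs0 zs h : h @ \oo --> 0 -> mulXs zs h @ \oo --> 0.
Proof. by move=> h0; elim: zs => //= z zs IH; exact: cvg_mulX0. Qed.

Definition sqsum N h : R := \sum_(i < N) h i ^+ 2.

Lemma sqsum_le N N' h : (N <= N')%N -> sqsum N h <= sqsum N' h.
Proof.
move=> /subnK <-; elim: (N' - N)%N => // d IH; rewrite addSn.
by apply: le_trans IH _; rewrite /sqsum big_ord_recr /= lerDl sqr_ge0.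
Qed.

(** The cross terms agree and the squares telescope, so only a boundary term is left, which tends to
    zero with [h]. *)
Lemma sqsum_mulX z h N :
  sqsum N.+1 (mulXr z h) = sqsum N.+1 (mulX z h) + (1 - z ^+ 2) * h N ^+ 2.
Proof.
elim: N => [|N IH].
  by rewrite /sqsum !big_ord_recl !big_ord0 /mulX /mulXr /=; ring.
rewrite /sqsum big_ord_recr/= -/(sqsum _ _) IH [in RHS]big_ord_recr/= -/(sqsum _ _).
by rewrite /mulX /mulXr /=; ring.
Qed.

(* [X - z] and [1 - z X] have the same modulus on the unit circle, so trading
   one factor for the other preserves the l2 norm of the coefficients. *)
Lemma sqsum_mulXr_le z h B : h @ \oo --> 0 ->
  (forall N, sqsum N (mulX z h) <= B) -> forall N, sqsum N (mulXr z h) <= B.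
Proof.
move=> h0 hB N; rewrite leNgt; apply/negP => BN.
have c : (1 - z ^+ 2) * h n ^+ 2 @[n --> \oo] --> 0.
  rewrite -[X in _ --> X](_ : (1 - z ^+ 2) * (0 * 0) = 0); last by ring.
  by apply: cvgM; [exact: cvg_cst|exact: cvgM].
have e0 : 0 < sqsum N (mulXr z h) - B by rewrite subr_gt0.
have /cvgrPdist_lt/(_ _ e0)[N1 _ hN1] := c.
have := hN1 (maxn N N1) (leq_maxr _ _); rewrite /= sub0r normrN => h1.
have h2 := sqsum_mulX z h (maxn N N1).
have h3 : sqsum N (mulXr z h) <= sqsum (maxn N N1).+1 (mulXr z h).
  by apply: sqsum_le; lia.
have h4 := hB (maxn N N1).+1; have := ler_norm ((1 - z ^+ 2) * h (maxn N N1) ^+ 2).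
by move: h1 h2 h3 h4 => /=; lra.
Qed.

(** The factors [X - z] are exchanged for [1 - z X] one at a time; the latter leave the constant
    coefficient of [h] unchanged. *)
Lemma sqsum_mulXs_ge zs h B : h @ \oo --> 0 ->
  (forall N, sqsum N (mulXs zs h) <= B) -> h 0%N ^+ 2 <= B.
Proof.
elim: zs h => [|z zs IH] h h0 hB.
  by have := hB 1%N; rewrite /sqsum big_ord_recl big_ord0 addr0.
have := IH (mulXr z h) (cvg_mulXr0 z h0); rewrite {2}/mulXr /= mulr0 subr0; apply.
move=> N; rewrite -mulXs_mulXr; apply: sqsum_mulXr_le hB N; exact: cvg_mulXs0.
Qed.

(** The coefficients of [h (r X)]. For [0 < r < 1] bounded sequences become square summable, and
    zeros are divided by [r]. *)
Definition dil r h : nat -> R := fun n => r ^+ n * h n.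

Lemma dil_mulXs r zs h : r != 0 ->
  dil r (mulXs zs h) = fun n => r ^+ size zs * mulXs [seq z / r | z <- zs] (dil r h) n.
Proof.
move=> r0; elim: zs => [|z zs IH] /=; first by apply/funext => n; rewrite mul1r.
apply/funext => n; rewrite /mulX {1}/dil.
have E m : r ^+ m * mulXs zs h m =
    r ^+ size zs * mulXs [seq z / r | z <- zs] (dil r h) m.
  by have := congr1 (fun F => F m) IH.
have -> : r ^+ (size zs).+1 * (prev (mulXs [seq z0 / r | z0 <- zs] (dil r h)) n -
     z / r * mulXs [seq z0 / r | z0 <- zs] (dil r h) n) =
   r * (r ^+ size zs * prev (mulXs [seq z0 / r | z0 <- zs] (dil r h)) n) -
     z * (r ^+ size zs * mulXs [seq z0 / r | z0 <- zs] (dil r h) n).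
  by rewrite exprS; field.
rewrite -E; case: n => [|n] /=; first by ring.
by rewrite -E exprS; ring.
Qed.

Lemma mulXs0 zs h : mulXs zs h 0%N = (-1) ^+ size zs * (\prod_(z <- zs) z) * h 0%N.
Proof.
elim: zs => [|z zs IH] /=; first by rewrite big_nil expr0 !mul1r.
by rewrite /mulX /= IH big_cons exprS; ring.
Qed.

(** Jensen's inequality in l2 form. Digits of modulus at most one bound the squared norm of
    [f (r X)] by [(1 - r ^+ 2)^-1], and with it [h 0]; the constant coefficient of [f] makes the
    product of [h 0] and the zeros equal to one up to sign. *)
Lemma calB_jensen f zs h M r : calB R f -> coef_le M h -> f = mulXs zs h ->
  0 < r < 1 -> r ^+ (size zs).*2 * (1 - r ^+ 2) <= (\prod_(z <- zs) z) ^+ 2.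
Proof.
move=> Bf hM fE /andP[r0 r1].
have q1 : 0 < 1 - r ^+ 2 by rewrite subr_gt0 expr_lt1 ?ltW.
set P := \prod_(z <- zs) z.
have P1 : P ^+ 2 * h 0%N ^+ 2 = 1.
  have : mulXs zs h 0%N = 1 by rewrite -fE; case: Bf.
  rewrite mulXs0 => /(congr1 (fun u => u ^+ 2)).
  by rewrite expr1n !exprMn sqrr_sign mul1r.
have dil0 : dil r h @ \oo --> 0.
  apply/cvgrPdist_lt => e e0.
  have M1 : 0 < M + 1 by rewrite ltr_wpDl ?(coef_le_ge0 hM).
  have [|N hN] := @expr_small _ r (e / (M + 1)) _ (divr_gt0 e0 M1).
    by rewrite gtr0_norm.
  exists N => // n Nn; rewrite /dil /= sub0r normrN normrM normrX.
  have := hN n Nn; rewrite ltr_pdivlMr//; apply: le_lt_trans.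
  by rewrite ler_wpM2l// (le_trans (hM n))// lerDl.
have sum_le N : sqsum N (dil r f) <= (1 - r ^+ 2)^-1.
  apply: (@le_trans _ _ (\sum_(i < N) (r ^+ 2) ^+ i)).
    apply: ler_sum => i _; rewrite /dil exprMn -!exprM mulnC.
    rewrite ler_piMr ?exprn_ge0 ?(ltW r0)//.
    by rewrite -real_normK ?num_real// exprn_ile1// calB_le.
  have := @subrX1 R (r ^+ 2) N => E.
  rewrite -(ler_pM2l q1) divff ?gt_eqF//.
  have -> : (1 - r ^+ 2) * \sum_(i < N) (r ^+ 2) ^+ i = 1 - (r ^+ 2) ^+ N.
    by rewrite -opprB mulNr -E opprB.
  by rewrite gerBl !exprn_ge0 ?ltW.
have rk : 0 < r ^+ (size zs).*2 by rewrite exprn_gt0.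
have := @sqsum_mulXs_ge [seq z / r | z <- zs] (dil r h) ((1 - r ^+ 2)^-1 / r ^+ (size zs).*2) dil0.
rewrite {2}/dil expr0 mul1r => H.
have {}H : h 0%N ^+ 2 <= (1 - r ^+ 2)^-1 / r ^+ (size zs).*2.
  apply: H => N; have := sum_le N; rewrite fE dil_mulXs ?gt_eqF// ler_pdivlMr//.
  rewrite /sqsum mulr_suml; congr (_ <= _); apply: eq_bigr => i _.
  by rewrite exprMn -exprM muln2 mulrC.
rewrite -invfM -(ler_pM2l (ltr0Sn R 0)) in H.
have P2 : 0 < P ^+ 2.
  rewrite lt_neqAle sqr_ge0 andbT eq_sym; apply/eqP => P0.
  by move: P1; rewrite P0 mul0r => /eqP; rewrite eq_sym oner_eq0.
have D : 0 < (1 - r ^+ 2) * r ^+ (size zs).*2 by rewrite mulr_gt0.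
have := H; rewrite !mul1r -(ler_pM2l P2) P1 ler_pdivlMr// mul1r.
by rewrite mulrC.
Qed.

End Jensen.

(** * Sign changes at zeros *)

Section SignChange.
Variable R : realType.
Implicit Types (a f h : nat -> R) (r t x z e : R) (F u : R -> R).

(** The two signs are not tied to the two sides of [z], so the negation gives a weak sign on a full
    neighbourhood. *)
Definition sign_change F z := forall e, 0 < e ->
  (exists2 x, `|x - z| < e & F x < 0) /\ (exists2 x, `|x - z| < e & 0 < F x).

Lemma sign_changeN F z : sign_change F z -> sign_change (fun x => - F x) z.
Proof.
move=> ch e /ch[[x xz Fx] [y yz Fy]]; split; [exists y|exists x] => //.
  by rewrite oppr_lt0.
by rewrite oppr_gt0.
Qed.

Lemma not_sign_change F z : ~ sign_change F z -> exists s, (s = 1 \/ s = -1) /\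
  exists2 e : R, 0 < e & forall x, `|x - z| < e -> 0 <= s * F x.
Proof.
move=> /existsNP[e /not_implyP[e0 /not_andP[]]] h.
  exists 1; split; [by left|exists e => // x xz; rewrite mul1r leNgt].
  by apply/negP => Fx; apply: h; exists x.
exists (-1); split; [by right|exists e => // x xz; rewrite mulN1r oppr_ge0 leNgt].
by apply/negP => Fx; apply: h; exists x.
Qed.

Lemma near_sign u z : {for z, continuous u} -> u z != 0 ->
  exists2 e : R, 0 < e & forall x, `|x - z| < e -> 0 < u z * u x.
Proof.
move=> cu uz; have u0 : 0 < `|u z| by rewrite normr_gt0.
have /cvgrPdist_lt/(_ _ u0)/nbhs_ballP[e e0 he] := cu.
exists e => // x xz; have /= := he x.
rewrite /ball /= distrC => /(_ xz); rewrite distrC ltr_norml => /andP[h1 h2].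
have [uz0|uz0] := ltP 0 (u z).
  by apply: mulr_gt0 => //; move: h1; rewrite gtr0_norm//; lra.
have {}uz0 : u z < 0 by rewrite lt_neqAle uz.
by rewrite nmulr_rgt0//; move: h2; rewrite ltr0_norm//; lra.
Qed.

Lemma sign_change_odd F u z k e0 : 0 < e0 -> odd k ->
    (forall x, `|x - z| < e0 -> F x = (x - z) ^+ k * u x) ->
    {for z, continuous u} -> u z != 0 ->
  sign_change F z.
Proof.
move=> e00 ok FE cu uz e ep; have [e1 e10 h1] := near_sign cu uz.
pose d : R := Num.min (Num.min e0 e) e1 / 2.
have d0 : 0 < d by rewrite divr_gt0// !lt_min e00 ep e10.
have [de0 de de1] : [/\ d < e0, d < e & d < e1].
  have m0 : Num.min (Num.min e0 e) e1 <= e0 by rewrite !ge_min lexx.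
  have m1 : Num.min (Num.min e0 e) e1 <= e by rewrite !ge_min lexx orbT.
  have m2 : Num.min (Num.min e0 e) e1 <= e1 by rewrite ge_min lexx orbT.
  by rewrite /d; split; lra.
have E1 : z + d - z = d by ring.
have E2 : z - d - z = - d by ring.
have n1 : `|z + d - z| = d by rewrite E1 gtr0_norm.
have n2 : `|z - d - z| = d by rewrite E2 normrN gtr0_norm.
have dk : 0 < d ^+ k by rewrite exprn_gt0.
have F1 : F (z + d) = d ^+ k * u (z + d) by rewrite FE ?n1// E1.
have F2 : F (z - d) = - (d ^+ k * u (z - d)).
  by rewrite FE ?n2// E2 exprNn -signr_odd ok expr1 mulN1r mulNr.
have s1 := h1 (z + d); have s2 := h1 (z - d); rewrite n1 n2 in s1 s2.
have [uz0|uz0] := ltP 0 (u z).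
  split; [exists (z - d)|exists (z + d)]; rewrite ?n1 ?n2//.
    by rewrite F2 oppr_lt0 mulr_gt0// -(pmulr_rgt0 _ uz0) s2.
  by rewrite F1 mulr_gt0// -(pmulr_rgt0 _ uz0) s1.
have {}uz0 : u z < 0 by rewrite lt_neqAle uz.
split; [exists (z + d)|exists (z - d)]; rewrite ?n1 ?n2//.
  by rewrite F1 pmulr_rlt0// -(nmulr_rgt0 _ uz0) s1.
by rewrite F2 oppr_gt0 pmulr_rlt0// -(nmulr_rgt0 _ uz0) s2.
Qed.

(** The zero is the supremum of the points of the interval with negative value. Negative values
    accumulate there; to its right the values are nonnegative, and nonzero close by because zeros
    are isolated. *)
Lemma sign_change_zero F (a b : R) : a < b -> F a < 0 -> 0 < F b ->
    (forall x, a <= x <= b -> {for x, continuous F}) ->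
    (forall z, a <= z <= b -> F z = 0 ->
      exists2 e : R, 0 < e & forall x, 0 < `|x - z| < e -> F x != 0) ->
  exists2 z, a <= z <= b & F z = 0 /\ sign_change F z.
Proof.
move=> ab Fa Fb cF iso.
pose E := [set x | a <= x <= b /\ F x < 0].
have Ea : E a by split=> //; rewrite lexx ltW.
have hE : has_sup E by split; [exists a|exists b => x [/andP[]]].
pose z := sup E.
have zE x : E x -> x <= z by move=> Ex; apply: ub_le_sup => //; case: hE.
have zab : a <= z <= b.
  by rewrite zE//=; apply: ge_sup => [|x [/andP[]]//]; exists a.
have [za zb] := andP zab.
have adh e : 0 < e -> exists2 x, E x & `|x - z| < e.
  move=> e0; have [x Ex hx] := sup_adherent e0 hE; exists x => //.
  by have := zE x Ex; rewrite ltr_norml -/z in hx * => hz; apply/andP; split; lra.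
have Fz1 : F z <= 0.
  rewrite leNgt; apply/negP => Fz0.
  have [e e0 he] := near_sign (cF z zab) (lt0r_neq0 Fz0).
  have [x [_ Fx] xz] := adh e e0.
  by have := he x xz; rewrite pmulr_rgt0// => /(lt_trans Fx); rewrite ltxx.
have zltb : z < b.
  by rewrite lt_neqAle zb andbT; apply: contraTneq Fb => <-; rewrite -leNgt.
have right e : 0 < e -> exists2 x, z < x <= b & `|x - z| < e.
  move=> e0; exists (Num.min (z + e / 2) b).
    by rewrite lt_min ge_min lexx orbT andbT; apply/andP; split=> //; lra.
  have h1 : Num.min (z + e / 2) b <= z + e / 2 by rewrite ge_min lexx.
  have h2 : z < Num.min (z + e / 2) b by rewrite lt_min zltb andbT; lra.
  by rewrite ltr_norml; apply/andP; split; lra.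
have Fright x : z < x <= b -> 0 <= F x.
  move=> /andP[zx xb]; rewrite leNgt; apply/negP => Fx.
  have : x <= z by apply: zE; split=> //; rewrite xb (le_trans za (ltW zx)).
  by rewrite leNgt zx.
have Fz : F z = 0.
  apply/le_anti; rewrite Fz1 /= leNgt; apply/negP => Fz0.
  have [e e0 he] := near_sign (cF z zab) (ltr0_neq0 Fz0).
  have [x zx xz] := right e e0.
  by have := he x xz; rewrite nmulr_rgt0// ltNge Fright.
exists z => //; split => // e e0; split.
  by have [x [_ Fx] xz] := adh e e0; exists x.
have [d d0 hd] := iso z zab Fz.
have m0 : 0 < Num.min e d by rewrite lt_min e0.
have [x zx xz] := right _ m0; exists x.
  by apply: lt_le_trans xz _; rewrite ge_min lexx.
rewrite lt_neqAle Fright// andbT eq_sym; apply: hd; apply/andP; split.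
  by rewrite normr_gt0 subr_eq0 gt_eqF//; case/andP: zx.
by apply: lt_le_trans xz _; rewrite ge_min lexx orbT.
Qed.

Lemma prev_le M h : coef_le M h -> coef_le M (prev h).
Proof. by move=> hM [|n] /=; rewrite ?normr0 ?(coef_le_ge0 hM). Qed.

Lemma mulX_le M z h : coef_le M h -> coef_le (M + `|z| * M) (mulX z h).
Proof.
move=> hM n; rewrite /mulX; apply: le_trans (ler_normB _ _) _.
by apply: lerD; [exact: prev_le|rewrite normrM ler_wpM2l].
Qed.

Lemma mulXs_le M zs h : coef_le M h -> exists N, coef_le N (mulXs zs h).
Proof.
move=> hM; elim: zs => [|z zs [N hN]]; first by exists M.
by exists (N + `|z| * N); exact: mulX_le.
Qed.

Lemma psum_mulX M z h x : coef_le M h -> `|x| < 1 ->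
  psum (mulX z h) x = (x - z) * psum h x.
Proof.
move=> hM x1; have zM : coef_le (`|z| * M) (fun n => z * h n).
  by move=> n; rewrite normrM ler_wpM2l.
rewrite /mulX (psumB (prev_le hM) zM)// (psumZ z hM)//.
by rewrite (psum_shift (prev_le hM))//= add0r mulrBl.
Qed.

Lemma psum_mulXs M zs h x : coef_le M h -> `|x| < 1 ->
  psum (mulXs zs h) x = \prod_(z <- zs) (x - z) * psum h x.
Proof.
move=> hM x1; elim: zs => [|z zs IH]; first by rewrite big_nil mul1r.
have [N hN] := mulXs_le zs hM.
by rewrite big_cons mulXsE (psum_mulX z hN)// IH mulrA.
Qed.

Lemma mulX_divX M f z : coef_le M f -> `|z| < 1 -> psum f z = 0 ->
  f = mulX z (divX z f).
Proof.
move=> fM z1 fz; apply/funext => -[|n]; rewrite /mulX /=.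
  by rewrite sub0r; apply/eqP; rewrite -addr_eq0 -(psum_divX0 fM)// fz.
by rewrite (divXS n fM)// addrK.
Qed.

(* Jensen's bound forbids zeros of infinite order. *)
Lemma calB_zero_order f z : calB R f -> `|z| < 1 -> psum f z = 0 ->
  exists k M h, [/\ coef_le M h, f = mulXs (nseq k.+1 z) h & psum h z != 0].
Proof.
move=> Bf z1 fz; apply: contrapT => hno.
have all k : exists M h, coef_le M h /\ f = mulXs (nseq k.+1 z) h.
  elim: k => [|k [M [h [hM fE]]]].
    exists (1 / (1 - `|z|)), (divX z f); split; first exact/coef_le_divX/z1/calB_le.
    exact: mulX_divX (calB_le Bf) z1 fz.
  have hz : psum h z = 0.
    by apply/eqP; apply: contrapT => /negP hz; apply: hno; exists k, M, h.
  exists (M / (1 - `|z|)), (divX z h); split; first exact: coef_le_divX.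
  rewrite -addn1 nseqD /mulXs foldr_cat /= -/(mulXs _ _).
  by rewrite -(mulX_divX hM z1 hz).
have z0 : 0 < `|z| by rewrite normr_gt0 (calB_zero_neq0 Bf).
pose r := (1 + `|z|) / 2.
have r0 : 0 < r < 1 by apply/andP; split; rewrite /r; lra.
have rz : 1 < r / `|z| by rewrite ltr_pdivlMr// mul1r /r; lra.
clearbody r; have [rp r1] := andP r0.
have q1 : 0 < 1 - r ^+ 2 by rewrite subr_gt0 expr_lt1 ?ltW.
(* For this [n] a zero of order [n.+1] violates Jensen's bound, because [r] exceeds the modulus of
   [z]. *)
have [|n hn] := @expr_large R ((r / `|z|) ^+ 2) (1 - r ^+ 2)^-1.
  by rewrite exprn_egt1.
have [M [h [hM fE]]] := all n.
have := calB_jensen Bf hM fE r0.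
rewrite size_nseq big_nseq iter_mulr_1 -mul2n !exprM mulrC => jb.
have zn : 0 < (`|z| ^+ 2) ^+ n.+1 by rewrite !exprn_gt0.
have : (r / `|z|) ^+ 2 ^+ n.+1 <= (1 - r ^+ 2)^-1.
  rewrite !expr_div_n ler_pdivrMr// ler_pdivlMl//.
  by rewrite real_normK ?num_real// [leRHS]exprAC.
rewrite leNgt => /negP; apply; apply: lt_le_trans hn _.
by rewrite ler_weXn2l// ltW// exprn_egt1.
Qed.

Lemma calB_zeros_isolated f z : calB R f -> `|z| < 1 -> psum f z = 0 ->
  exists2 e : R, 0 < e & forall x, 0 < `|x - z| < e -> psum f x != 0.
Proof.
move=> Bf z1 fz; have [k [M [h [hM fE hz]]]] := calB_zero_order Bf z1 fz.
have [e e0 he] := near_sign (psum_continuous hM z1) hz.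
exists (Num.min e (1 - `|z|)) => [|x]; first by rewrite lt_min e0 subr_gt0.
rewrite lt_min => /andP[xz0 /andP[xz1 xz2]].
have x1 : `|x| < 1.
  by have := ler_normD (x - z) z; rewrite subrK; lra.
rewrite fE (psum_mulXs _ hM)// mulf_neq0//.
  rewrite prodf_seq_neq0; apply/allP => y /nseqP[-> _] /=.
  by rewrite -normr_gt0.
by have := he x xz1; apply: contraTneq => ->; rewrite mulr0 ltxx.
Qed.

Lemma psum_mulX_sign_change h l (u : R -> R) F M : coef_le M h -> `|l| < 1 ->
    psum h l != 0 -> {for l, continuous u} -> u l != 0 ->
    (forall x, `|x| < 1 -> F x = (x - l) * (u x * psum h x)) ->
  sign_change F l.
Proof.
move=> hM l1 hl cu ul FE.
apply: (@sign_change_odd F (fun x => u x * psum h x) l 1 (1 - `|l|)) => //.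
- by rewrite subr_gt0.
- move=> x xl; rewrite expr1 FE//.
  by have := ler_normD (x - l) l; rewrite subrK; lra.
- by apply: cvgM => //; exact: (psum_continuous hM l1).
- by rewrite mulf_neq0.
Qed.

(* If [f] changes sign at neither zero, both are double, and Jensen's bound for
   the radius with [r ^+ 2 = 4 / 5] gives [(g * l) ^+ 4 >= 256 / 3125 > 1 / 16]. *)
Lemma calB_sign_change_or f g l : calB R f -> `|g| < 1 -> `|l| < 1 -> g != l ->
    `|g * l| < 2^-1 -> psum f g = 0 -> psum f l = 0 ->
  sign_change (psum f) g \/ sign_change (psum f) l.
Proof.
move=> Bf g1 l1 gl gl2 fg fl; apply: contrapT => /not_orP[ng nl].
have cst1 t : {for t, continuous (fun=> 1 : R)} by exact: cst_continuous.
have fM := calB_le Bf; have f1 := mulX_divX fM g1 fg.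
set h1 := divX g f in f1; have h1M : coef_le (1 / (1 - `|g|)) h1 by exact: coef_le_divX.
(* A simple zero would be a sign change, so [g] is at least a double zero; [l] is treated in the
   same way below. *)
have h1g : psum h1 g = 0.
  apply/eqP; apply: contrapT => /negP h; apply: ng.
  apply: (psum_mulX_sign_change h1M g1 h (cst1 g)) => [|x x1]; first exact: oner_neq0.
  by rewrite mul1r f1 (psum_mulX g h1M).
have E1 := mulX_divX h1M g1 h1g.
set h2 := divX g h1 in E1; have h2M := coef_le_divX h1M g1; rewrite -/h2 in h2M.
have f2 x : `|x| < 1 -> psum f x = (x - g) * ((x - g) * psum h2 x).
  by move=> x1; rewrite f1 (psum_mulX g h1M)// E1 (psum_mulX g h2M).
have lg : l - g != 0 by rewrite subr_eq0 eq_sym.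
have h2l : psum h2 l = 0.
  by apply/eqP; move/eqP: fl; rewrite f2// !mulf_eq0 (negPf lg).
have E2 := mulX_divX h2M l1 h2l.
set h3 := divX l h2 in E2; have h3M := coef_le_divX h2M l1; rewrite -/h3 in h3M.
have h3l : psum h3 l = 0.
  apply/eqP; apply: contrapT => /negP h; apply: nl.
  apply: (@psum_mulX_sign_change h3 l (fun x => (x - g) ^+ 2) _ _ h3M) => //.
  - by apply: cvgM; apply: cvgB; [exact: cvg_id|exact: cvg_cst|exact: cvg_id|exact: cvg_cst].
  - by rewrite expf_neq0.
  - by move=> x x1; rewrite f2// E2 (psum_mulX l h3M)//; ring.
have E3 := mulX_divX h3M l1 h3l.
set h4 := divX l h3 in E3; have h4M := coef_le_divX h3M l1; rewrite -/h4 in h4M.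
have fE : f = mulXs [:: g; g; l; l] h4 by rewrite f1 E1 E2 E3.
pose r : R := Num.sqrt (4 / 5).
have r2 : r ^+ 2 = 4 / 5 by rewrite sqr_sqrtr//; lra.
have r0 : 0 < r < 1.
  rewrite sqrtr_gt0; apply/andP; split; first lra.
  rewrite -sqrtr1 ltr_sqrt; lra.
have := calB_jensen Bf h4M fE r0.
rewrite !big_cons big_nil mulr1 /= (_ : (4.*2 = 2 * 4)%N)// exprM r2.
have P0 : 0 <= `|g * l| by [].
have P2 : `|g * l| ^+ 2 <= 4^-1.
  by have := ler_pM P0 P0 (ltW gl2) (ltW gl2); rewrite expr2; lra.
have P4 : (`|g * l| ^+ 2) ^+ 2 <= 16^-1.
  have s0 := exprn_ge0 2 P0.
  by have := ler_pM s0 s0 P2 P2; rewrite [_ ^+ 2 ^+ 2]expr2; lra.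
have -> : (g * (g * (l * l))) ^+ 2 = (`|g * l| ^+ 2) ^+ 2.
  by rewrite real_normK ?num_real//; ring.
by move: P4; rewrite (_ : (4 / 5) ^+ 4 = 256 / 625 :> R); [lra|field].
Qed.

End SignChange.

(** * Crossing parity of chains *)

Ltac xor_leaf u :=
  lazymatch u with
  | _ (+) _ => fail
  | true => fail
  | false => fail
  | _ => case: u
  end.
Ltac xor_cases :=
  repeat match goal with
  | |- context [?u (+) ?v] => first [xor_leaf u | xor_leaf v]
  end; by [].

Section Parity.

Fixpoint par (U : Type) (e : U -> U -> bool) (x : U) (s : seq U) : bool :=
  if s is y :: s' then e x y (+) par e y s' else false.

Lemma par_cat U (e : U -> U -> bool) x s t :
  par e x (s ++ t) = par e x s (+) par e (last x s) t.
Proof. by elim: s x => //= y s IH x; rewrite IH addbA. Qed.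

Lemma par_map U V (f : V -> U) (e : U -> U -> bool) x s :
  par e (f x) [seq f z | z <- s] = par (fun z z' => e (f z) (f z')) x s.
Proof. by elim: s x => //= y s IH x; rewrite IH. Qed.

(** Each inner vertex is counted twice, so a coboundary sums to its endpoint values. *)
Lemma par_potential U (p : U -> bool) (e : U -> U -> bool) x s :
  (forall z z', e z z' = p z (+) p z') -> par e x s = p x (+) p (last x s).
Proof.
move=> ep; elim: s x => [|y s IH] x /=; first by rewrite addbb.
by rewrite IH ep addbA -(addbA (p x)) addbb addbF.
Qed.

Lemma par_false U (e : U -> U -> bool) x s :
  (forall z z', e z z' = false) -> par e x s = false.
Proof. by move=> e0; rewrite (@par_potential _ xpred0). Qed.

Lemma par_eq U (e e' : U -> U -> bool) x s :
  (forall z z', e z z' = e' z z') -> par e x s = par e' x s.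
Proof. by move=> ee'; elim: s x => //= y s IH x; rewrite IH ee'. Qed.

(* The boundary of a product of two paths is the sum of the boundaries of its
   cells. *)
Lemma par_grid U V (P : Type) (c : P -> P -> bool) (F : U -> V -> P)
    (rU : rel U) (rV : rel V) x s y t :
    (forall x x' y y', rU x x' -> rV y y' ->
      c (F x y) (F x' y) (+) c (F x y') (F x' y') (+)
      c (F x y) (F x y') (+) c (F x' y) (F x' y') = false) ->
    path rU x s -> path rV y t ->
  par (fun z z' => c (F z y) (F z' y)) x s (+)
  par (fun z z' => c (F z (last y t)) (F z' (last y t))) x s (+)
  par (fun w w' => c (F x w) (F x w')) y t (+)
  par (fun w w' => c (F (last x s) w) (F (last x s) w')) y t = false.
Proof.
move=> cell.
have strip z z' : rU z z' -> path rV y t ->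
    c (F z y) (F z' y) (+) c (F z (last y t)) (F z' (last y t)) (+)
    par (fun w w' => c (F z w) (F z w')) y t (+)
    par (fun w w' => c (F z' w) (F z' w')) y t = false.
  move=> zz'; elim: t y => [|w t IH] y /=; first by rewrite addbb.
  move=> /andP[yw /IH E]; have := cell _ _ _ _ zz' yw; move: E.
  by xor_cases.
move=> pU pV; elim: s x pU => [|z s IH] x /=; first by rewrite addbb.
move=> /andP[xz /IH E]; have := strip _ _ xz pV; move: E.
by xor_cases.
Qed.

(** A discrete Stokes formula modulo two: in the sum over all cells the inner edges cancel, and the
    sides where [A] or [G] vanishes drop out. The side [k = 0] telescopes to [th 0%N (+) th N],
    which is odd, so some cell is odd. *)
Lemma telescope_par (A G : nat -> nat -> bool) (th : nat -> bool) N :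
    (forall k, A k 0%N = false) -> (forall k, A k N = false) ->
    (forall l, G N l = false) ->
    (forall l, G 0%N l = th l (+) th l.+1) -> th 0%N != th N ->
  exists k l, [/\ (k < N)%N, (l < N)%N &
    A k.+1 l (+) A k.+1 l.+1 (+) G k.+1 l (+) G k l].
Proof.
move=> A0 AN GN G0 thN; apply: contrapT => hno.
have cell k l : (k < N)%N -> (l < N)%N ->
    G k l = G k.+1 l (+) (A k.+1 l (+) A k.+1 l.+1).
  move=> kN lN; have : ~~ (A k.+1 l (+) A k.+1 l.+1 (+) G k.+1 l (+) G k l).
    by apply/negP => h; apply: hno; exists k, l.
  by case: (A k.+1 l); case: (A k.+1 l.+1); case: (G k.+1 l); case: (G k l).
pose S k n := \big[addb/false]_(l < n) G k l.
have row k n : (k < N)%N -> (n <= N)%N ->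
    S k n = S k.+1 n (+) (A k.+1 0%N (+) A k.+1 n).
  move=> kN; elim: n => [|n IH] nN.
    by rewrite /S !big_ord0 addbb.
  rewrite /S !big_ord_recr/= -!/(S _ _) IH ?(ltnW nN)// cell//.
  by xor_cases.
have rowN k : (k < N)%N -> S k N = S k.+1 N.
  by move=> kN; rewrite row// A0 AN addbb addbF.
have SN : S N N = false.
  by rewrite /S; elim/big_ind: _ => // -[] [].
have S0 n : S 0%N n = th 0%N (+) th n.
  elim: n => [|n IH]; first by rewrite /S big_ord0 addbb.
  by rewrite /S big_ord_recr/= -/(S _ _) IH G0; xor_cases.
have Sall k : (k <= N)%N -> S 0%N N = S k N.
  by elim: k => // k IH kN; rewrite -rowN// IH// ltnW.
have := Sall N (leqnn N); rewrite SN S0.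
by move: thN; case: (th 0%N); case: (th N).
Qed.

End Parity.

(** * Crossings of a ray in the plane *)

Section Crossing.
Variable R : realType.
Variables (a b : R * R).

Let D := a.1 * b.2 - a.2 * b.1.
(** For [D] nonzero, [al] and [be] are the coordinates in the basis [(a, b)] times [D ^+ 2], a
    positive factor that avoids division and keeps signs. *)
Definition al (z : R * R) := D * (z.1 * b.2 - z.2 * b.1).
Definition be (z : R * R) := D * (a.1 * z.2 - a.2 * z.1).

(* Crossings of the ray [be = 0], [al > 0] by a short segment. *)
Definition crosses (z w : R * R) := ((0 <= be z) (+) (0 <= be w)) && (0 < al z).

Lemma al_sub z w : al (z - w) = al z - al w. Proof. by rewrite /al /=; ring. Qed.
Lemma be_sub z w : be (z - w) = be z - be w. Proof. by rewrite /be /=; ring. Qed.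

Lemma norm1_le (z : R * R) : `|z.1| <= `|z|.
Proof. by rewrite prod_normE le_max lexx. Qed.
Lemma norm2_le (z : R * R) : `|z.2| <= `|z|.
Proof. by rewrite prod_normE le_max lexx orbT. Qed.
Lemma norm_le_pair (z : R * R) (e : R) : `|z.1| <= e -> `|z.2| <= e -> `|z| <= e.
Proof. by move=> h1 h2; rewrite prod_normE ge_max h1 h2. Qed.

Definition albe_cst := `|D| * (`|a| + `|b|) *+ 2.

Lemma al_le z : `|al z| <= albe_cst * `|z|.
Proof.
rewrite /al /albe_cst normrM -mulrnAr -!mulrA ler_wpM2l//.
have h1 := norm1_le z; have h2 := norm2_le z.
have b1 := norm1_le b; have b2 := norm2_le b; have a0 := normr_ge0 a.
apply: le_trans (ler_normB _ _) _; rewrite !normrM mulr2n mulrDl.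
apply: lerD; rewrite [leRHS]mulrC; apply: ler_pM => //; lra.
Qed.

Lemma be_le z : `|be z| <= albe_cst * `|z|.
Proof.
rewrite /be /albe_cst normrM -mulrnAr -!mulrA ler_wpM2l//.
have h1 := norm1_le z; have h2 := norm2_le z.
have a1 := norm1_le a; have a2 := norm2_le a; have b0 := normr_ge0 b.
apply: le_trans (ler_normB _ _) _; rewrite !normrM mulr2n mulrDl.
apply: lerD; apply: ler_pM => //; lra.
Qed.

Hypothesis D0 : D != 0.

Lemma albe_norm z (c : R) : `|al z| <= c -> `|be z| <= c ->
  `|z| <= (`|a| + `|b|) / D ^+ 2 * c.
Proof.
move=> hA hB.
have D2 : 0 < D ^+ 2 by rewrite lt_neqAle sqr_ge0 eq_sym expf_neq0.
have E1 : D ^+ 2 * z.1 = a.1 * al z + b.1 * be z by rewrite /al /be /D; ring.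
have E2 : D ^+ 2 * z.2 = a.2 * al z + b.2 * be z by rewrite /al /be /D; ring.
have a1 := norm1_le a; have a2 := norm2_le a.
have b1 := norm1_le b; have b2 := norm2_le b.
rewrite mulrAC mulrC.
apply: norm_le_pair; rewrite -ler_pdivrMl ?invr_gt0// invrK.
  have -> : D ^+ 2 * `|z.1| = `|D ^+ 2 * z.1| by rewrite normrM (gtr0_norm D2).
  rewrite E1.
  apply: le_trans (ler_normD _ _) _; rewrite (normrM a.1) (normrM b.1) mulrDl.
  by apply: lerD; apply: ler_pM.
have -> : D ^+ 2 * `|z.2| = `|D ^+ 2 * z.2| by rewrite normrM (gtr0_norm D2).
  rewrite E2.
apply: le_trans (ler_normD _ _) _; rewrite (normrM a.2) (normrM b.2) mulrDl.
by apply: lerD; apply: ler_pM.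
Qed.

(** When [al z] and [be z] have modulus at most [albe_cst * rho], the norm of [z] is at most
    [sector_cst * rho]. *)
Definition sector_cst := (`|a| + `|b|) / D ^+ 2 * albe_cst.

Lemma sector_cst_ge0 : 0 <= sector_cst.
Proof.
by rewrite /sector_cst /albe_cst mulr_ge0 ?divr_ge0 ?sqr_ge0 ?addr_ge0.
Qed.

(* A set far from the origin in comparison with its diameter misses the ray,
   or the crossing parity on it is a coboundary. *)
Lemma crosses_sector (S : set (R * R)) (rho : R) :
    (forall z w, S z -> S w -> `|z - w| <= rho) ->
    (forall z, S z -> sector_cst * rho < `|z|) ->
  exists p, forall z w, S z -> S w -> crosses z w = p z (+) p w.
Proof.
move=> diam far.
have dal z w : S z -> S w -> `|al z - al w| <= albe_cst * rho.
  move=> Sz Sw; rewrite -al_sub; apply: le_trans (al_le _) _.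
  by rewrite ler_wpM2l ?diam// /albe_cst mulrn_wge0// mulr_ge0// addr_ge0.
have dbe z w : S z -> S w -> `|be z - be w| <= albe_cst * rho.
  move=> Sz Sw; rewrite -be_sub; apply: le_trans (be_le _) _.
  by rewrite ler_wpM2l ?diam// /albe_cst mulrn_wge0// mulr_ge0// addr_ge0.
have out z : S z -> `|be z| <= albe_cst * rho -> albe_cst * rho < `|al z|.
  move=> Sz hb; rewrite ltNge; apply/negP => ha.
  have := albe_norm ha hb; rewrite mulrA -/sector_cst leNgt => /negP; apply.
  exact: far.
(* If two points straddle the line [be = 0], then [be z] is small, so [al z] exceeds the variation
   of [al] on [S] and [al] has a constant sign there. *)
have [[z [w [Sz Sw zw]]]|hno] := pselect (exists z w, [/\ S z, S w & (0 <= be z) (+) (0 <= be w)]).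
  have bz : `|be z| <= albe_cst * rho.
    have := dbe z w Sz Sw; move: zw; rewrite !ler_norml.
    by case: leP => // hz; case: leP => //= hw _ /andP[h1 h2]; apply/andP; split; lra.
  have az := out z Sz bz.
  have near u : S u -> `|al z - al u| < `|al z|.
    by move=> Su; apply: le_lt_trans (dal z u Sz Su) az.
  have [alz|alz] := ltP 0 (al z).
    exists (fun u => 0 <= be u) => u u' Su Su'; rewrite /crosses.
    have -> : 0 < al u.
      by have := near u Su; rewrite (gtr0_norm alz) ltr_norml => /andP[]; lra.
    by rewrite andbT.
  exists xpred0 => u u' Su Su'; rewrite /crosses.
  have /negPf -> : ~~ (0 < al u).
    rewrite -leNgt; have := near u Su.
    by rewrite (ler0_norm alz) ltr_norml => /andP[]; lra.
  by rewrite andbF.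
exists xpred0 => u u' Su Su'; rewrite /crosses.
case E : (_ (+) _) => //=; exfalso; apply: hno; by exists u, u'.
Qed.

End Crossing.

(** * Chains of digit sequences *)

Section Chains.
Variable R : realType.
Implicit Types (f : nat -> R) (x y : nat -> bool) (T : R * R) (k m n : nat).

(** The point of the attractor with address [x]. *)
Definition pt T x : R * R := (val T.1 x, val T.2 x).

(* The points of [branch f true] and [branch f false] differ by the values of
   the power series [f]. *)
Definition branch f (c : bool) : nat -> bool := fun n => f n == if c then 1 else -1.

Lemma branch0 f c : calB R f -> branch f c 0%N = c.
Proof.
move=> [f0 _]; rewrite /branch f0; case: c; rewrite ?eqxx//.
by apply/eqP => h; lra.
Qed.

Lemma branch_diff f n : calB R f ->
  (branch f true n)%:R - (branch f false n)%:R = f n.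
Proof.
have n11 : (1 == -1 :> R) = false by apply/eqP => h; lra.
have n01 : (0 == 1 :> R) = false by rewrite eq_sym oner_eq0.
have n01' : (0 == -1 :> R) = false by rewrite eq_sym oppr_eq0 oner_eq0.
move=> Bf; rewrite /branch; case: (calB_digit n Bf) => [|[]] ->.
- by rewrite eqxx eq_sym n11 sub0r.
- by rewrite n01 n01' subr0.
- by rewrite eqxx n11 subr0.
Qed.

Lemma branch_val f t : calB R f -> `|t| < 1 ->
  val t (branch f true) - val t (branch f false) = psum f t.
Proof.
move=> Bf t1; rewrite val_diff//; congr psum.
by apply/funext => n; exact: branch_diff.
Qed.

Lemma branch_agree f f' n c : agree n f f' -> agree n (branch f c) (branch f' c).
Proof. by move=> h i ni; rewrite /branch h. Qed.

(** Words with different first digits are linked through the two branches of [f], whose points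
    nearly coincide when [f] nearly vanishes. The construction is repeated inside each cylinder down
    to depth [m], where a direct jump is allowed. As in [path], the starting word is left out of the
    list. *)
Fixpoint chain f m x y : seq (nat -> bool) :=
  if m is m'.+1 then
    if x 0%N == y 0%N
    then [seq scons (x 0%N) z | z <- chain f m' (stail x) (stail y)]
    else [seq scons (x 0%N) z | z <- chain f m' (stail x) (stail (branch f (x 0%N)))]
      ++ branch f (y 0%N) ::
         [seq scons (y 0%N) z | z <- chain f m' (stail (branch f (y 0%N))) (stail y)]
  else [:: y].

Lemma scons_headK c x : x 0%N = c -> scons c (stail x) = x.
Proof. by move=> <-; exact: scons_tail. Qed.

Lemma last_scons c x s : x 0%N = c ->
  last x [seq scons c z | z <- s] = scons c (last (stail x) s).
Proof. by move=> xc; rewrite -{1}(scons_headK xc) last_map. Qed.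

Lemma last_chain f m x y : calB R f -> last x (chain f m x y) = y.
Proof.
move=> Bf; elim: m x y => //= m IH x y; case: eqP => [xy|_].
  by rewrite last_scons// IH scons_headK.
by rewrite last_cat /= last_scons ?branch0// IH scons_headK.
Qed.

Lemma pt_cons T c x : `|T.1| < 1 -> `|T.2| < 1 ->
  pt T (scons c x) = (c%:R + T.1 * (pt T x).1, c%:R + T.2 * (pt T x).2).
Proof. by move=> h1 h2; rewrite /pt !val_cons. Qed.

Lemma pt_cons_diff T r c x y : `|T.1| <= r -> `|T.2| <= r -> r < 1 ->
  `|pt T (scons c x) - pt T (scons c y)| <= r * `|pt T x - pt T y|.
Proof.
move=> h1 h2 r1; have l1 := le_lt_trans h1 r1; have l2 := le_lt_trans h2 r1.
have cancel (t u v : R) : c%:R + t * u - (c%:R + t * v) = t * (u - v) by ring.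
rewrite !pt_cons//; apply: norm_le_pair => /=; rewrite cancel normrM.
  by apply: ler_pM => //; exact: (norm1_le (pt T x - pt T y)).
by apply: ler_pM => //; exact: (norm2_le (pt T x - pt T y)).
Qed.

Lemma pt_agree T r n x y : `|T.1| <= r -> `|T.2| <= r -> r < 1 -> agree n x y ->
  `|pt T x - pt T y| <= r ^+ n / (1 - r).
Proof.
by move=> h1 h2 r1 xy; apply: norm_le_pair => /=; exact: val_agree.
Qed.

Lemma pt_lip T T' r x : r < 1 -> `|T.1| <= r -> `|T.2| <= r ->
  `|T'.1| <= r -> `|T'.2| <= r -> `|pt T x - pt T' x| <= `|T - T'| / (1 - r) ^+ 2.
Proof.
move=> r1 h1 h2 h1' h2'.
have q0 : 0 <= (1 - r) ^- 2 by rewrite invr_ge0 sqr_ge0.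
apply: norm_le_pair => /=; apply: le_trans (val_lip _ r1 _ _) _ => //.
  by rewrite ler_wpM2r//; exact: (norm1_le (T - T')).
by rewrite ler_wpM2r//; exact: (norm2_le (T - T')).
Qed.

Definition hop T (e : R) : rel (nat -> bool) := fun x y => `|pt T x - pt T y| <= e.

(** A jump either stays in a cylinder of depth [m] or joins the two branches, and prepending digits
    only contracts it. *)
Lemma chain_hop f m x y T r e : calB R f ->
    0 <= r < 1 -> `|T.1| <= r -> `|T.2| <= r ->
    `|psum f T.1| <= e -> `|psum f T.2| <= e -> r ^+ m / (1 - r) <= e ->
  path (hop T e) x (chain f m x y).
Proof.
move=> Bf /andP[r0 r1] h1 h2.
elim: m x y e => [|m IH] x y e e1 e2 hm /=.
  by rewrite andbT /hop; apply: le_trans hm; exact: pt_agree.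
have e0 : 0 <= e := le_trans (normr_ge0 _) e1.
(* The tails are chained to depth [m] only, hence the weaker bound [e']; contraction by [r] brings
   it back below [e]. *)
pose e' := Num.max e (r ^+ m / (1 - r)).
have IH' z w : path (hop T e') z (chain f m z w).
  by apply: IH; rewrite le_max ?e1 ?e2 ?lexx ?orbT.
have cons_hop c z w : hop T e' z w -> hop T e (scons c z) (scons c w).
  move=> zw; apply: le_trans (pt_cons_diff c z w h1 h2 r1) _.
  apply: le_trans (ler_wpM2l r0 zw) _; rewrite /e' maxr_pMr// ge_max.
  by rewrite mulrA -exprS hm andbT ler_piMl// ltW.
have cons_path c z w : z 0%N = c ->
    path (hop T e) z [seq scons c u | u <- chain f m (stail z) w].
  move=> zc; rewrite -{1}(scons_headK zc) path_map.
  by apply: sub_path (IH' (stail z) w) => u v; exact: cons_hop.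
case: eqP => [xy|/eqP xy]; first exact: cons_path.
rewrite cat_path /= cons_path//= cons_path ?branch0// andbT.
rewrite last_scons// last_chain// scons_headK ?branch0//.
have jump : hop T e (branch f true) (branch f false).
  by apply: norm_le_pair; rewrite /= branch_val// (le_lt_trans _ r1).
case: (x 0%N) (y 0%N) xy => [] [] // _.
by rewrite /hop distrC.
Qed.

End Chains.

(** * Homotopy invariance of the crossing parity *)

Section Homotopy.
Variable R : realType.
Variables (a b : R * R).
Hypothesis D0 : a.1 * b.2 - a.2 * b.1 != 0.
Local Notation cr := (crosses a b).
Local Notation K := (sector_cst a b).

Definition ucat (u : seq bool) x : nat -> bool := foldr scons x u.

Lemma agree_scons n c x y : agree n x y -> agree n.+1 (scons c x) (scons c y).
Proof. by move=> xy [|i] //= ?; exact: xy. Qed.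

Lemma agree_stail n (x y : nat -> bool) : agree n.+1 x y -> agree n (stail x) (stail y).
Proof. by move=> xy i ni; exact: xy. Qed.

Lemma agree_le U n m (x y : nat -> U) : (n <= m)%N -> agree m x y -> agree n x y.
Proof. by move=> nm xy i ni; apply: xy; apply: leq_trans nm. Qed.

(* At the centre [T] the two branches have the same image, so the coarse chain
   only jumps within cylinders; a finer chain for nearby data stays in the same
   cylinders and has the same crossing parity up to endpoint terms. *)
Lemma chain_homotopy (f f' : nat -> R) (rho : R) (k : nat) :
    calB R f -> calB R f' -> agree k f f' -> 0 <= rho ->
  forall (F F' : (nat -> bool) -> R * R) m x y x' y', (k <= m)%N ->
    (forall z, K * (2 * rho) + rho < `|F z|) ->
    (forall z z', agree k z z' -> `|F' z - F z'| <= rho) ->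
    (forall u, F (ucat u (branch f true)) = F (ucat u (branch f false))) ->
    agree k x' x -> agree k y' y ->
  par (fun z w => cr (F' z) (F' w)) x' (chain f' m x' y') (+)
  par (fun z w => cr (F z) (F w)) x (chain f k x y) =
  cr (F' x') (F x) (+) cr (F' y') (F y).
Proof.
move=> Bf Bf'; elim: k => [|k IH] ff' rho0 F F' m x y x' y' km far close glue xx yy.
  (* At [k = 0] closeness holds for all pairs of words, so the images of [F] and [F'] together have
     diameter at most [2 * rho] and crossings on them are a coboundary. *)
  have [||p hp] := @crosses_sector _ _ _ D0 [set z | exists w, z = F w \/ z = F' w] (2 * rho).
  - have c0 z z' : `|F' z - F z'| <= rho by apply: close.
    have mid u v w : `|u - w| <= rho -> `|v - w| <= rho -> `|u - v : R * R| <= 2 * rho.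
      by move=> h1 h2; apply: le_trans (ler_distD w u v) _; rewrite (distrC w); lra.
    move=> _ _ [z [->|->]] [w [->|->]].
    + by apply: (mid _ _ (F' z)); rewrite distrC.
    + by rewrite distrC; apply: (le_trans (c0 _ _)); lra.
    + by apply: (le_trans (c0 _ _)); lra.
    + exact: (mid _ _ (F z)).
  - move=> _ [z [->|->]]; first by have := far z; lra.
    have h : `|F' z - F z| <= rho by apply: close.
    have := ler_normD (F' z) (F z - F' z); rewrite addrC subrK (distrC (F z)).
    by have := far z; lra.
  have hF z w : cr (F z) (F w) = p (F z) (+) p (F w).
    by apply: hp; [exists z; left|exists w; left].
  have hF' z w : cr (F' z) (F' w) = p (F' z) (+) p (F' w).
    by apply: hp; [exists z; right|exists w; right].
  have hM z w : cr (F' z) (F w) = p (F' z) (+) p (F w).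
    by apply: hp; [exists z; right|exists w; left].
  rewrite (@par_potential _ (p \o F'))// (@par_potential _ (p \o F))//=.
  by rewrite last_chain// !hM; xor_cases.
case: m km => // m km.
have ff1 : agree k f f' by apply: agree_le ff'.
(* A prepended digit is absorbed into the maps, which is why the induction is over arbitrary [F] and
   [F']. *)
have step c u v u' v' : u 0%N = c -> u' 0%N = c -> v 0%N = c -> v' 0%N = c ->
    agree k.+1 u' u -> agree k.+1 v' v ->
    par (fun z w => cr (F' z) (F' w)) u'
      [seq scons c z | z <- chain f' m (stail u') (stail v')] (+)
    par (fun z w => cr (F z) (F w)) u
      [seq scons c z | z <- chain f k (stail u) (stail v)] =
    cr (F' u') (F u) (+) cr (F' v') (F v).
  move=> uc uc' vc vc' /agree_stail uu /agree_stail vv.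
  rewrite -{1}(scons_headK uc) -{1}(scons_headK uc') !par_map.
  have := IH ff1 rho0 (F \o scons c) (F' \o scons c) m _ _ _ _ km _ _ _ uu vv.
  rewrite /= !scons_headK//; apply=> //.
    by move=> z z' zz; apply: close; exact: agree_scons.
  by move=> w; exact: (glue (c :: w)).
have x0 : x' 0%N = x 0%N by apply: xx.
have y0 : y' 0%N = y 0%N by apply: yy.
rewrite /= x0 y0; case: eqP => [xy|/eqP xy]; first by apply: step => //; rewrite y0.
have bb c : agree k.+1 (branch f' c) (branch f c).
  by apply: branch_agree => i ik; rewrite ff'.
have E1 := step (x 0%N) x (branch f (x 0%N)) x' (branch f' (x 0%N)).
have {}E1 := E1 erefl x0 (branch0 _ Bf) (branch0 _ Bf') xx (bb _).
have E2 := step (y 0%N) (branch f (y 0%N)) y (branch f' (y 0%N)) y'.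
have {}E2 := E2 (branch0 _ Bf) (branch0 _ Bf') erefl y0 (bb _) yy.
rewrite !par_cat/= !last_scons// !last_chain// !scons_headK ?branch0//.
set p1 := par _ x' _ in E1 *; set p2 := par _ x _ in E1 *.
set q1 := par _ (branch f' _) _ in E2 *; set q2 := par _ (branch f _) _ in E2 *.
(* The coarse path does not move when it changes branch. The jump of the fine path stays within
   [rho] of that common point, where crossings are again a coboundary. *)
have Fb : F (branch f (x 0%N)) = F (branch f (y 0%N)).
  have g := glue [::]; rewrite /= in g.
  by case: (x 0%N) (y 0%N) xy => [] [].
have cb c : `|F' (branch f' c) - F (branch f c)| <= rho by exact: close (bb c).
pose w := F (branch f (x 0%N)).
have near z : z = F' (branch f' (x 0%N)) \/ z = F' (branch f' (y 0%N)) \/ z = w ->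
    `|z - w| <= rho.
  case=> [->|[->|->]].
  - exact: (cb (x 0%N)).
  - by rewrite /w Fb; exact: (cb (y 0%N)).
  - by rewrite subrr normr0.
have [||p hp] := @crosses_sector _ _ _ D0 [set z | z = F' (branch f' (x 0%N)) \/
    z = F' (branch f' (y 0%N)) \/ z = w] (2 * rho).
- move=> u v /near h1 /near h2.
  by apply: le_trans (ler_distD w u v) _; rewrite (distrC w); lra.
- move=> z /near h; have := far (branch f (x 0%N)); rewrite -/w.
  have := ler_normD z (w - z); rewrite addrC subrK (distrC w).
  by lra.
have {hp} : cr (F' (branch f' (x 0%N))) w (+)
    cr (F' (branch f' (x 0%N))) (F' (branch f' (y 0%N))) (+)
    cr w w (+) cr (F' (branch f' (y 0%N))) w = false.
  by rewrite !hp /=; tauto || xor_cases.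
rewrite -Fb -/w in E2 *; rewrite -/w in E1.
clearbody p1 p2 q1 q2 w; move: E1 E2.
by xor_cases.
Qed.

End Homotopy.

(** Each corner term belongs to two sides and cancels in the sum. *)
Lemma addb_corners (p1 p2 p3 p4 q1 q2 q3 q4 c1 c2 c3 c4 : bool) :
    p1 (+) q1 = c1 (+) c2 -> p2 (+) q2 = c3 (+) c4 ->
    p3 (+) q3 = c1 (+) c3 -> p4 (+) q4 = c2 (+) c4 ->
  p1 (+) p2 (+) p3 (+) p4 = q1 (+) q2 (+) q3 (+) q4.
Proof.
have E (p q c d : bool) : p (+) q = c (+) d -> p = c (+) d (+) q.
  by move=> <-; rewrite -addbA addbb addbF.
move=> /E-> /E-> /E-> /E->; case: c1; case: c2; case: c3; case: c4;
by case: q1; case: q2; case: q3; case: q4.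
Qed.

Section Block.
Variable R : realType.
Variables (a b : R * R).
Hypothesis D0 : a.1 * b.2 - a.2 * b.1 != 0.
Local Notation cr := (crosses a b).
Local Notation K := (sector_cst a b).
Implicit Types (G : (nat -> bool) -> R * R) (v w : R * R) (x : nat -> bool)
  (s t : seq (nat -> bool)).

Definition parP G w x s := par (fun z z' => cr (G z - w) (G z' - w)) x s.
Definition parQ G w x s := par (fun z z' => cr (w - G z) (w - G z')) x s.

(* The winding parity around [v] of the boundary of the difference of the two
   paths [x :: s] and [x :: t]. *)
Definition block G v x s t :=
  parP G (G x + v) x s (+) parP G (G (last x t) + v) x s (+)
  parQ G (G x - v) x t (+) parQ G (G (last x s) - v) x t.

(** If all differences stayed far from [v], every cell of the product of the two paths would be
    small compared with its distance to [v] and have an even boundary, so the whole boundary would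
    be even. *)
Lemma block_near T (e : R) v x s t :
    path (hop T e) x s -> path (hop T e) x t -> block (pt T) v x s t ->
  exists y z, `|pt T y - pt T z - v| <= K * (2 * e).
Proof.
move=> ps pt' bl; apply: contrapT => hno.
have far y z : K * (2 * e) < `|pt T y - pt T z - v|.
  by rewrite ltNge; apply/negP => h; apply: hno; exists y, z.
have := @par_grid _ _ _ cr (fun y z => pt T y - pt T z - v) _ _ x s x t _ ps pt'.
have EP (w : nat -> bool) : parP (pt T) (pt T w + v) x s = par
    (fun z z' => cr (pt T z - pt T w - v) (pt T z' - pt T w - v)) x s.
  by apply: par_eq => z z'; rewrite !opprD !addrA.
have EQ (w : nat -> bool) : parQ (pt T) (pt T w - v) x t = par
    (fun z z' => cr (pt T w - pt T z - v) (pt T w - pt T z' - v)) x t.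
  by apply: par_eq => z z'; rewrite ![_ - v - _]addrAC.
move: bl; rewrite /block !EP !EQ => -> H.
suff : true = false by []; apply: H.
move=> y y' z z' yy zz.
have e0 : 0 <= e := le_trans (normr_ge0 _) yy.
pose S : set (R * R) := [set u | exists y1 z1,
  [/\ y1 = y \/ y1 = y', z1 = z \/ z1 = z' & u = pt T y1 - pt T z1 - v]].
have hopy y1 y2 : y1 = y \/ y1 = y' -> y2 = y \/ y2 = y' -> `|pt T y1 - pt T y2| <= e.
  by case=> ->; case=> ->; rewrite ?subrr ?normr0// distrC.
have hopz z1 z2 : z1 = z \/ z1 = z' -> z2 = z \/ z2 = z' -> `|pt T z1 - pt T z2| <= e.
  by case=> ->; case=> ->; rewrite ?subrr ?normr0// distrC.
have [||p hp] := @crosses_sector _ _ _ D0 S (2 * e).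
- move=> _ _ [y1 [z1 [hy1 hz1 ->]]] [y2 [z2 [hy2 hz2 ->]]].
  have -> : pt T y1 - pt T z1 - v - (pt T y2 - pt T z2 - v) =
      (pt T y1 - pt T y2) - (pt T z1 - pt T z2).
    by apply/pair_equal_spec; split => /=; ring.
  apply: le_trans (ler_normB _ _) _.
  by have := hopy _ _ hy1 hy2; have := hopz _ _ hz1 hz2; lra.
- by move=> _ [y1 [z1 [_ _ ->]]]; exact: far.
have hS y1 z1 : y1 = y \/ y1 = y' -> z1 = z \/ z1 = z' -> S (pt T y1 - pt T z1 - v).
  by exists y1, z1.
by rewrite !hp; try (apply: hS; tauto); xor_cases.
Qed.

(** Each side changes parity by its endpoint terms only, and these cancel at the corners. The moving
    point, the fixed endpoint and [v] each move by at most [d], hence [3 * d]. *)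
Lemma block_homotopy (f f' : nat -> R) (T T' : R * R) (d : R) v v' k m x y z :
    calB R f -> calB R f' -> agree k f f' -> (k <= m)%N ->
    `|T.1| < 1 -> `|T.2| < 1 -> psum f T.1 = 0 -> psum f T.2 = 0 ->
    (forall u u', agree k u u' -> `|pt T' u - pt T u'| <= d) ->
    `|v' - v| <= d ->
    (forall (w u : nat -> bool), w = x \/ w = z -> K * (2 * (3 * d)) + 3 * d < `|pt T u - (pt T w + v)|) ->
    (forall (w u : nat -> bool), w = x \/ w = y -> K * (2 * (3 * d)) + 3 * d < `|pt T w - v - pt T u|) ->
  block (pt T') v' x (chain f' m x y) (chain f' m x z) =
  block (pt T) v x (chain f k x y) (chain f k x z).
Proof.
move=> Bf Bf' ff' km T1 T2 fT1 fT2 close vv farP farQ.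
have d0 : 0 <= d := le_trans (normr_ge0 _) vv.
have d3 : 0 <= 3 * d by rewrite mulr_ge0.
have glue u : pt T (ucat u (branch f true)) = pt T (ucat u (branch f false)).
  elim: u => [|c u IH] /=; last by rewrite !pt_cons// IH.
  rewrite /pt; congr (_, _); apply/eqP; rewrite -subr_eq0 branch_val//; exact/eqP.
have refl u : agree k u u by [].
have tri (p q r p' q' r' : R * R) : `|p' - p| <= d -> `|q' - q| <= d ->
    `|r' - r| <= d -> `|p' - (q' + r') - (p - (q + r))| <= 3 * d.
  move=> h1 h2 h3.
  have -> : p' - (q' + r') - (p - (q + r)) = (p' - p) - (q' - q) - (r' - r).
    by apply/pair_equal_spec; split => /=; ring.
  have := ler_normB (p' - p - (q' - q)) (r' - r).
  by have := ler_normB (p' - p) (q' - q); lra.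
have E (p q r : R * R) : p - q - r = p - (r + q) by rewrite (addrC r) opprD addrA.
have sideP (w u : nat -> bool) : w = x \/ w = z ->
    parP (pt T') (pt T' w + v') x (chain f' m x u) (+)
    parP (pt T) (pt T w + v) x (chain f k x u) =
    cr (pt T' x - (pt T' w + v')) (pt T x - (pt T w + v)) (+)
    cr (pt T' u - (pt T' w + v')) (pt T u - (pt T w + v)).
  move=> wx; apply: (@chain_homotopy _ _ _ D0 f f' (3 * d) k Bf Bf' ff' d3
    (fun u => pt T u - (pt T w + v)) (fun u => pt T' u - (pt T' w + v'))) => //.
  - by move=> u'; exact: farP.
  - by move=> u1 u2 uu; apply: tri => //; apply: close.
  - by move=> u'; rewrite glue.
have sideQ (w u : nat -> bool) : w = x \/ w = y ->
    parQ (pt T') (pt T' w - v') x (chain f' m x u) (+)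
    parQ (pt T) (pt T w - v) x (chain f k x u) =
    cr (pt T' w - v' - pt T' x) (pt T w - v - pt T x) (+)
    cr (pt T' w - v' - pt T' u) (pt T w - v - pt T u).
  move=> wx; apply: (@chain_homotopy _ _ _ D0 f f' (3 * d) k Bf Bf' ff' d3
    (fun u => pt T w - v - pt T u) (fun u => pt T' w - v' - pt T' u)) => //.
  - by move=> u'; exact: farQ.
  - move=> u1 u2 uu; rewrite (E _ v) (E _ v').
    by apply: tri => //; apply: close.
  - by move=> u'; rewrite glue.
rewrite /block !last_chain//.
have q1 := sideQ x z (or_introl erefl); have q2 := sideQ y z (or_intror erefl).
have p1 := sideP x y (or_introl erefl); have p2 := sideP z y (or_intror erefl).
rewrite !(E _ v) !(E _ v') in q1 q2.
exact: addb_corners p1 p2 q1 q2.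
Qed.

End Block.

Section Lattice.
Variable R : realType.
Variables (a b : R * R).
Hypothesis D0 : a.1 * b.2 - a.2 * b.1 != 0.
Implicit Types (G : (nat -> bool) -> R * R) (v w : R * R) (x : nat -> bool)
  (s t : seq (nat -> bool)).

(* Translates of the block by the lattice spanned by [a] and [b] tile a large
   parallelogram, whose boundary winds once around any point in the middle. *)
Lemma block_lattice G v x s t (M : R) : G x = 0 -> G (last x s) = a -> G (last x t) = b ->
    (forall z, `|al a b (G z)| <= M) -> (forall z, `|be a b (G z)| <= M) ->
    `|al a b v| <= M -> `|be a b v| <= M ->
  forall N : nat, 2 * M < N%:R * (a.1 * b.2 - a.2 * b.1) ^+ 2 ->
  exists k l : nat, [/\ (k <= N.*2)%N, (l <= N.*2)%N &
    block a b G (v + (a *+ k - a *+ N) + (b *+ l - b *+ N)) x s t].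
Proof.
move=> Gx Gs Gt aM bM av bv N hN.
set D := a.1 * b.2 - a.2 * b.1 in hN *.
have D2 : 0 < D ^+ 2 by rewrite lt_neqAle sqr_ge0 eq_sym expf_neq0.
pose u (k l : nat) : R * R := v + (a *+ k - a *+ N) + (b *+ l - b *+ N).
have u1 k l : (u k l).1 = v.1 + (k%:R - N%:R) * a.1 + (l%:R - N%:R) * b.1.
  rewrite /u !pairMnE /= -(mulr_natl a.1 k) -(mulr_natl a.1 N).
  by rewrite -(mulr_natl b.1 l) -(mulr_natl b.1 N); ring.
have u2 k l : (u k l).2 = v.2 + (k%:R - N%:R) * a.2 + (l%:R - N%:R) * b.2.
  rewrite /u !pairMnE /= -(mulr_natl a.2 k) -(mulr_natl a.2 N).
  by rewrite -(mulr_natl b.2 l) -(mulr_natl b.2 N); ring.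
have alE k l : al a b (u k l) = al a b v + (k%:R - N%:R) * D ^+ 2.
  by rewrite /al u1 u2 /D; ring.
have beE k l : be a b (u k l) = be a b v + (l%:R - N%:R) * D ^+ 2.
  by rewrite /be u1 u2 /D; ring.
have NN : N.*2%:R = N%:R + N%:R :> R by rewrite -addnn natrD.
have alN z : al a b (- z) = - al a b z by rewrite /al /=; ring.
have beN z : be a b (- z) = - be a b z by rewrite /be /=; ring.
have aM' z : - M <= al a b (G z) <= M by rewrite -ler_norml.
have bM' z : - M <= be a b (G z) <= M by rewrite -ler_norml.
move: av bv; rewrite !ler_norml => /andP[av1 av2] /andP[bv1 bv2].
(* On [l = 0] and [l = N.*2] the paths keep one sign of [be]. On [k = N.*2] the ray is missed
   because [al] is not positive; on [k = 0], where [al] is positive, the parity is the change of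
   sign of [be]. *)
have [|||||k [l [kN lN bl]]] := @telescope_par (fun k l => parP a b G (u k l) x s)
    (fun k l => parQ a b G (- u k l) x t)
    (fun l => 0 <= be a b (- u 0%N l)) N.*2.
- move=> k; apply: par_false => z z'; rewrite /crosses.
  have pos (w : nat -> bool) : 0 <= be a b (G w - u k 0%N).
    rewrite be_sub beE; have /andP[] := bM' w; move: hN; lra.
  by rewrite !pos.
- move=> k; apply: par_false => z z'; rewrite /crosses.
  have neg (w : nat -> bool) : (0 <= be a b (G w - u k N.*2)) = false.
    apply/negbTE; rewrite -ltNge be_sub beE NN; have /andP[] := bM' w; move: hN; lra.
  by rewrite !neg.
- move=> l; apply: par_false => z z'; rewrite /crosses.
  have -> : (0 < al a b (- u N.*2 l - G z)) = false.
    apply/negbTE; rewrite -leNgt al_sub alN alE NN; have /andP[] := aM' z; move: hN; lra.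
  by rewrite andbF.
- move=> l; rewrite /parQ (@par_potential _ (fun w : nat -> bool => 0 <= be a b (- u 0%N l - G w))).
    rewrite Gx Gt subr0; congr (_ (+) (0 <= _)).
    rewrite be_sub !beN !beE -natr1 /be -/D; ring.
  move=> z z'; rewrite /crosses.
  have -> : 0 < al a b (- u 0%N l - G z).
    rewrite al_sub alN alE; have /andP[] := aM' z; move: hN; lra.
  by rewrite andbT.
- have -> : 0 <= be a b (- u 0%N 0%N) by rewrite beN beE; move: hN; lra.
  have -> : (0 <= be a b (- u 0%N N.*2)) = false.
    by apply/negbTE; rewrite -ltNge beN beE NN; move: hN; lra.
  by [].
(* The odd cell is the block at [u k.+1 l]: neighbouring translates share sides, and its fourth side
   is the one indexed by [k]. *)
exists k.+1, l; split=> //; first exact: ltnW.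
rewrite -/(u k.+1 l) /block Gx Gs Gt add0r sub0r.
have pair_ext (p q : R * R) : p.1 = q.1 -> p.2 = q.2 -> p = q.
  by case: p q => [? ?] [? ?] /= -> ->.
clearbody u; rewrite (_ : b + u k.+1 l = u k.+1 l.+1); last first.
  by apply: pair_ext; rewrite /= ?u1 ?u2 -[l.+1%:R in RHS]natr1; ring.
rewrite (_ : a - u k.+1 l = - u k l)//.
by apply: pair_ext; rewrite /= ?u1 ?u2 -[k.+1%:R]natr1; ring.
Qed.

End Lattice.

(** * The odd block *)

Section Area.
Variable R : realType.

(** The rectangles have total area below that of the unit square. *)
Lemma square_not_covered n (c : nat -> R * R) (p q : R) : 0 <= p -> 0 <= q ->
    n%:R * (4 * p * q) < 1 ->
  exists v : R * R, [/\ 0 <= v.1 <= 1, 0 <= v.2 <= 1 &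
    forall i, (i < n)%N -> p < `|v.1 - (c i).1| \/ q < `|v.2 - (c i).2|].
Proof.
move=> p0 q0 small; apply: contrapT => hno.
pose mu := (@lebesgue_measure R \x @lebesgue_measure R)%E.
pose A i : set (R * R) := `[(c i).1 - p, (c i).1 + p] `*` `[(c i).2 - q, (c i).2 + q].
pose S : set (R * R) := `[0, 1] `*` `[0, 1].
have itvE (x y : R) : x <= y -> lebesgue_measure (`[x, y]%classic : set R) = (y - x)%:E.
  move=> xy; rewrite lebesgue_measure_itv /= lte_fin.
  by case: ltgtP xy => // ->; rewrite subrr.
have muE (x y z t : R) : x <= y -> z <= t ->
    mu (`[x, y]%classic `*` `[z, t]%classic) = ((y - x) * (t - z))%:E.
  move=> xy zt; rewrite EFinM -(itvE _ _ xy) -(itvE _ _ zt).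
  exact: product_measure1E.
have mS : mu S = 1%E by rewrite muE// subr0 mul1r.
have mA i : mu (A i) = (4 * p * q)%:E.
  by rewrite muE; [congr EFin; ring|lra|lra].
have cover : S `<=` \big[setU/set0]_(i < n) A i.
  move=> v [/= v1 v2]; rewrite -bigcup_mkord.
  apply: contrapT => h; apply: hno; exists v; split.
  - by move: v1; rewrite in_itv.
  - by move: v2; rewrite in_itv.
  move=> i ni; apply: contrapT => /not_orP[/negP h1 /negP h2].
  apply: h; exists i => //; rewrite -!leNgt !ler_distl in h1 h2.
  by split; rewrite /= in_itv.
have mm (x y z t : R) : measurable (`[x, y]%classic `*` `[z, t]%classic : set (R * R)).
  exact: measurableX.
have := le_measure mu; move=> /(_ S (\big[setU/set0]_(i < n) A i)).
rewrite !inE => H.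
have {}H : (mu S <= mu (\big[setU/set0]_(i < n) A i))%E.
  by apply: H => //; [exact: mm|apply: bigsetU_measurable => i _; exact: mm].
have := le_trans H (@Boole_inequality _ _ _ mu A n (fun i _ => mm _ _ _ _)).
rewrite mS (eq_bigr (fun=> (4 * p * q)%:E)) => [|i _]; last exact: mA.
rewrite sumEFin lee_fin sumr_const card_ord -(mulr_natl _ n).
by rewrite leNgt small.
Qed.

(* [T] contracts areas by more than the number of pieces, so the translates of
   the attractor have measure zero. *)
Lemma translates_miss (T : R * R) (o : nat -> R * R) (J : nat) :
    `|T.1| < 1 -> `|T.2| < 1 -> T.1 != 0 -> T.2 != 0 -> `|T.1 * T.2| < 2^-1 ->
  exists v : R * R, [/\ 0 <= v.1 <= 1, 0 <= v.2 <= 1 &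
    exists2 rho : R, 0 < rho & forall j x, (j < J)%N ->
      rho < `|v - (pt T x - o j)|].
Proof.
move=> g1 l1 g0 l0 gl.
pose C (t : R) := (1 - `|t|)^-1.
have C0 t : `|t| < 1 -> 0 < C t by move=> t1; rewrite invr_gt0 subr_gt0.
(* The rectangles around the [J.+1] times [2 ^ m] cylinder centres have half-sides [2 * h], twice
   the cylinder radius, which leaves the margin [rho]. Their total area is [A] times the [m]-th
   power of twice the modulus of [T.1 * T.2]. *)
pose A : R := (J.+1)%:R * (16 * C T.1 * C T.2).
have A0 : 0 < A by rewrite !mulr_gt0// C0.
have [||m hm] := @expr_small _ (2 * `|T.1 * T.2|) A^-1.
- by rewrite normrM normr_id ger0_norm//; lra.
- by rewrite invr_gt0.
have {}hm := hm m (leqnn m).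
pose I : finType := ('I_J.+1 * m.-tuple bool)%type.
pose word (w : m.-tuple bool) : nat -> bool := nth false w.
pose i0 : I := (ord0, [tuple of nseq m false]).
pose cI (i : I) := pt T (word i.2) - o i.1.
pose h (t : R) := `|t| ^+ m * C t.
have h0 t : t != 0 -> `|t| < 1 -> 0 < h t.
  by move=> t0 t1; rewrite mulr_gt0 ?C0// exprn_gt0 ?normr_gt0.
have [|||v [v1 v2 hv]] := @square_not_covered #|I| (fun i => cI (nth i0 (enum I) i))
   (2 * h T.1) (2 * h T.2).
- by rewrite mulr_ge0// ltW// h0.
- by rewrite mulr_ge0// ltW// h0.
- rewrite card_prod card_ord card_tuple card_bool natrM natrX.
  have -> : (J.+1)%:R * 2 ^+ m * (4 * (2 * h T.1) * (2 * h T.2)) =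
      A * (2 * `|T.1 * T.2|) ^+ m.
    by rewrite /A /h normrM !exprMn; ring.
  rewrite mulrC -ltr_pdivlMr// div1r.
  by move: hm; rewrite ger0_norm// mulr_ge0.
exists v; split=> //; exists (Num.min (h T.1) (h T.2)); first by rewrite lt_min !h0.
move=> j x jJ.
pose w := [tuple x i | i < m].
have xw : agree m x (word w).
  by move=> i im; rewrite /word -[i]/(nat_of_ord (Ordinal im)) nth_mktuple.
pose i : I := (inord j, w).
have := hv (index i (enum I)).
rewrite cardE index_mem mem_enum nth_index ?mem_enum// => /(_ isT).
have oj : o (inord j : 'I_J.+1) = o j by rewrite inordK// ltnW.
have d1 : `|val T.1 x - val T.1 (word w)| <= h T.1 by exact: val_agree.
have d2 : `|val T.2 x - val T.2 (word w)| <= h T.2 by exact: val_agree.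
have tri (a b c : R) : `|a - c| <= `|a - b| + `|b - c| by exact: ler_distD.
rewrite /cI /= oj => -[hh|hh].
  apply: (@lt_le_trans _ _ `|(v - (pt T x - o j)).1|); last exact: norm1_le.
  apply: (@le_lt_trans _ _ (h T.1)); first by rewrite ge_min lexx.
  have := tri v.1 (val T.1 x - (o j).1) (val T.1 (word w) - (o j).1).
  rewrite (_ : val T.1 x - (o j).1 - (val T.1 (word w) - (o j).1) =
    val T.1 x - val T.1 (word w)); last by ring.
  by move: hh d1 => /=; lra.
apply: (@lt_le_trans _ _ `|(v - (pt T x - o j)).2|); last exact: norm2_le.
apply: (@le_lt_trans _ _ (h T.2)); first by rewrite ge_min lexx orbT.
have := tri v.2 (val T.2 x - (o j).2) (val T.2 (word w) - (o j).2).
rewrite (_ : val T.2 x - (o j).2 - (val T.2 (word w) - (o j).2) =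
  val T.2 x - val T.2 (word w)); last by ring.
by move: hh d2 => /=; lra.
Qed.

End Area.

Section Interior.
Variable R : realType.
Implicit Types (f : nat -> R) (x y z : nat -> bool) (t r e d w : R) (T v : R * R).

Definition zeros : nat -> bool := fun=> false.
Definition ones : nat -> bool := fun=> true.

Lemma pair_ext (p q : R * R) : p.1 = q.1 -> p.2 = q.2 -> p = q.
Proof. by case: p q => [? ?] [? ?] /= -> ->. Qed.

Lemma val_zeros t : `|t| < 1 -> val t zeros = 0.
Proof.
move=> t1; have := val_cons false zeros t1.
have -> : scons false zeros = zeros by apply/funext => -[].
rewrite add0r => h; apply/eqP; have : (1 - t) * val t zeros = 0 by rewrite mulrBl mul1r {1}h subrr.
move/eqP; rewrite mulf_eq0 subr_eq0 => /orP[/eqP t1'|//].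
by move: t1; rewrite -t1' normr1 ltxx.
Qed.

Lemma val_ones t : `|t| < 1 -> (1 - t) * val t ones = 1.
Proof.
move=> t1; have := val_cons true ones t1.
have -> : scons true ones = ones by apply/funext => -[].
by rewrite mulrBl mul1r => {1}->; rewrite addrK.
Qed.

Lemma val_negb t x : `|t| < 1 -> val t (fun n => ~~ x n) = val t ones - val t x.
Proof.
move=> t1; rewrite val_diff//; congr psum; apply/funext => i.
by case: (x i); rewrite /= ?subrr ?subr0.
Qed.

Lemma pt_negb T x : `|T.1| < 1 -> `|T.2| < 1 ->
  pt T (fun n => ~~ x n) = pt T ones - pt T x.
Proof. by move=> h1 h2; rewrite /pt !val_negb. Qed.

Definition target2 := scons false ones.

(** The point of [target2] is that of [ones] with its coordinates multiplied by those of [T], so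
    being off the diagonal makes the lattice two-dimensional. *)
Lemma chords_independent T : `|T.1| < 1 -> `|T.2| < 1 -> T.1 != T.2 ->
  (pt T ones).1 * (pt T target2).2 - (pt T ones).2 * (pt T target2).1 != 0.
Proof.
move=> h1 h2 h12; rewrite /pt /= /target2 !val_cons// !add0r.
have o1 := val_ones h1; have o2 := val_ones h2.
have n1 : val T.1 ones != 0.
  by apply: contra_eq_neq o1 => ->; rewrite mulr0 eq_sym oner_neq0.
have n2 : val T.2 ones != 0.
  by apply: contra_eq_neq o2 => ->; rewrite mulr0 eq_sym oner_neq0.
have -> : val T.1 ones * (T.2 * val T.2 ones) - val T.2 ones * (T.1 * val T.1 ones) =
  val T.1 ones * val T.2 ones * (T.2 - T.1) by ring.
by rewrite !mulf_neq0// subr_eq0 eq_sym.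
Qed.

Lemma pt_norm_le T r x : `|T.1| <= r -> `|T.2| <= r -> r < 1 ->
  `|pt T x| <= (1 - r)^-1.
Proof.
move=> h1 h2 r1.
have le t : `|t| <= r -> `|val t x| <= (1 - r)^-1.
  move=> tr; have t1 := le_lt_trans tr r1.
  apply: le_trans (psum_le (@word_coef_le R x) t1) _.
  by rewrite div1r lef_pV2 ?posrE; lra.
by apply: norm_le_pair; apply: le.
Qed.

Definition odd_block f T v k :=
  block (pt T ones) (pt T target2) (pt T) v zeros
    (chain f k zeros ones) (chain f k zeros target2).

(** Some [v] avoids, with a margin [rho], the finitely many shifted attractors that carry the sides
    of the blocks. One lattice translate of [v] then has an odd block, and [d] is chosen so that the
    distance required by the homotopy is exactly [rho]. *)
Lemma odd_block_exists f T r : calB R f -> `|T.1| <= r -> `|T.2| <= r -> 0 <= r < 1 ->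
    T.1 != 0 -> T.2 != 0 -> T.1 != T.2 -> `|T.1 * T.2| < 2^-1 ->
  exists v k d, [/\ 0 < d, r ^+ k / (1 - r) <= d / 2, odd_block f T v k &
    let far := sector_cst (pt T ones) (pt T target2) * (2 * (3 * d)) + 3 * d in
    (forall o x, o = zeros \/ o = target2 -> far < `|pt T x - (pt T o + v)|) /\
    (forall o x, o = zeros \/ o = ones -> far < `|pt T o - v - pt T x|)].
Proof.
move=> Bf h1 h2 /andP[r0 r1] n1 n2 n12 half.
have l1 := le_lt_trans h1 r1; have l2 := le_lt_trans h2 r1.
set a := pt T ones; set b := pt T target2.
have D0 : a.1 * b.2 - a.2 * b.1 != 0 by exact: chords_independent.
set D := a.1 * b.2 - a.2 * b.1 in D0.
have D2 : 0 < D ^+ 2 by rewrite lt_neqAle sqr_ge0 eq_sym expf_neq0.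
have C0 : 0 < (1 - r)^-1 by rewrite invr_gt0 subr_gt0.
have c0 : 0 <= albe_cst a b by rewrite /albe_cst mulrn_wge0// mulr_ge0// addr_ge0.
pose M := albe_cst a b * ((1 - r)^-1 + 1).
pose N := (Num.truncn (2 * M / D ^+ 2)).+1.
have hN : 2 * M < N%:R * D ^+ 2.
  by rewrite -ltr_pdivrMr//; exact: truncnS_gt.
pose L (k l : nat) : R * R := (a *+ k - a *+ N) + (b *+ l - b *+ N).
(* Up to the central symmetry of the attractor, the sides of a block sit at the offsets [0], [a] and
   [b]. *)
pose os := [seq L kl.1 kl.2 + o | kl <- [seq (k, l) | k <- iota 0 N.*2.+1, l <- iota 0 N.*2.+1],
   o <- [:: 0; a; b]].
have [v [v1 v2 [rho rho0 hrho]]] := translates_miss (nth 0 os) (size os) l1 l2 n1 n2 half.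
have miss (k l : nat) (o : R * R) x : (k <= N.*2)%N -> (l <= N.*2)%N -> o \in [:: 0; a; b] ->
    rho < `|v - (pt T x - (L k l + o))|.
  move=> kN lN ho.
  have os_in : L k l + o \in os.
    apply/allpairsP; exists ((k, l), o); split => //.
    by apply/allpairsP; exists (k, l); rewrite !mem_iota !add0n !ltnS.
  by rewrite -(nth_index 0 os_in); apply: hrho; rewrite index_mem.
have K0 : 0 <= sector_cst a b := sector_cst_ge0 a b.
pose d := rho / (sector_cst a b * 6 + 3).
have den : 0 < sector_cst a b * 6 + 3 by rewrite ltr_wpDl// mulr_ge0.
have d0 : 0 < d by rewrite divr_gt0.
have far : sector_cst a b * (2 * (3 * d)) + 3 * d = rho.
  transitivity (d * (sector_cst a b * 6 + 3)); first by move: (sector_cst a b) (d) => K e; ring.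
  by rewrite /d divfK// gt_eqF.
have [||k0 hk0] := @expr_small _ r (d / 2 / (1 - r)^-1).
- by rewrite ger0_norm.
- by rewrite !divr_gt0.
have {}hk0 : r ^+ k0 / (1 - r) <= d / 2.
  have := hk0 k0 (leqnn _); rewrite ger0_norm// ltr_pdivlMr// => /ltW.
  by [].
have pt0 : pt T zeros = 0 by rewrite /pt !val_zeros.
have vM : `|v| <= 1.
  by apply: norm_le_pair; rewrite ger0_norm; case/andP: v1; case/andP: v2.
have Mle (z : R * R) : `|z| <= (1 - r)^-1 + 1 -> `|al a b z| <= M /\ `|be a b z| <= M.
  by move=> hz; split; [apply: le_trans (al_le _ _ _) _|apply: le_trans (be_le _ _ _) _];
    rewrite ler_wpM2l.
have ptM x : `|pt T x| <= (1 - r)^-1 + 1.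
  by have := pt_norm_le x h1 h2 r1; lra.
have vM' : `|v| <= (1 - r)^-1 + 1 by move: vM C0; lra.
have [|||||||k [l [kN lN bl]]] := @block_lattice R a b D0 (pt T) v zeros
   (chain f k0 zeros ones) (chain f k0 zeros target2) M _ _ _ _ _ _ _ N hN.
- exact: pt0.
- by rewrite last_chain.
- by rewrite last_chain.
- by move=> z; case: (Mle _ (ptM z)).
- by move=> z; case: (Mle _ (ptM z)).
- by case: (Mle _ vM').
- by case: (Mle _ vM').
exists (v + L k l), k0, d; split => //; first by rewrite /odd_block /L addrA.
rewrite far; split => o x ho.
  rewrite distrC (_ : pt T o + (v + L k l) - pt T x = v - (pt T x - (L k l + pt T o))).
    by apply: miss => //; case: ho => ->; rewrite ?pt0 !inE eqxx ?orbT.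
  by move: (pt T o) (L k l) (pt T x) => p q u; apply: pair_ext => /=; ring.
(* Complementing the digits turns the reflected attractor into a translate of the attractor, so the
   same list of offsets applies. *)
rewrite (_ : pt T o - (v + L k l) - pt T x =
    - (v - (pt T (fun n => ~~ x n) - (L k l + (a - pt T o))))).
  rewrite normrN; apply: miss => //.
  by case: ho => ->; rewrite ?pt0 ?subr0 ?subrr !inE eqxx ?orbT.
rewrite pt_negb// -/a.
by move: (pt T o) (L k l) (pt T x) (a) => p q u a'; apply: pair_ext => /=; ring.
Qed.

End Interior.

(** * Closure of the interior *)

Section ClosureInterior.
Variable R : realType.
Implicit Types (f : nat -> R) (x y z : nat -> bool) (t r e d : R) (T v : R * R).

Local Notation far T d := (sector_cst (pt T ones) (pt T target2) * (2 * (3 * d)) + 3 * d).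

(* An odd block forces a crossing of the chains generated by [f'], and the
   crossing produces a series agreeing with [f] below [n] that is smaller than
   [f'] by a factor [2 K r ^+ n]. *)
Lemma crossing_improves f f' T T' v v' k d n r e :
    calB R f -> calB R f' -> agree n f f' -> (0 < n)%N -> (k <= n)%N ->
    0 <= r < 1 -> `|T.1| <= r -> `|T.2| <= r -> `|T'.1| <= r -> `|T'.2| <= r ->
    T.1 != T.2 -> psum f T.1 = 0 -> psum f T.2 = 0 ->
    r ^+ k / (1 - r) <= d / 2 -> `|T' - T| / (1 - r) ^+ 2 <= d / 2 -> `|v' - v| <= d ->
    odd_block f T v k ->
    (forall o x, o = zeros \/ o = target2 -> far T d < `|pt T x - (pt T o + v)|) ->
    (forall o x, o = zeros \/ o = ones -> far T d < `|pt T o - v - pt T x|) ->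
    \sum_(i < n) f i * T'.1 ^+ i = T'.1 ^+ n * v'.1 ->
    \sum_(i < n) f i * T'.2 ^+ i = T'.2 ^+ n * v'.2 ->
    0 < e -> `|psum f' T'.1| <= e -> `|psum f' T'.2| <= e ->
  exists2 f'', calB R f'' /\ agree n f f'' &
    let s := r ^+ n * (sector_cst (pt T ones) (pt T target2) * (2 * e)) in
    `|psum f'' T'.1| <= s /\ `|psum f'' T'.2| <= s.
Proof.
move=> Bf Bf' ff' n0 kn r01 h1 h2 h1' h2' n12 fT1 fT2 hk hT hv odd farP farQ p1 p2 e0 fe1 fe2.
have [r0 r1] := andP r01.
have l1 := le_lt_trans h1 r1; have l2 := le_lt_trans h2 r1.
have l1' := le_lt_trans h1' r1; have l2' := le_lt_trans h2' r1.
have D0 := chords_independent l1 l2 n12.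
have C0 : 0 < (1 - r)^-1 by rewrite invr_gt0 subr_gt0.
have [||m0 hm0] := @expr_small _ r (e / (1 - r)^-1).
- by rewrite ger0_norm.
- by rewrite divr_gt0.
(* Deep enough for the jumps inside cylinders to be at most [e], and at least [k] as the homotopy
   demands. *)
pose m := maxn m0 k.
have rm : r ^+ m / (1 - r) <= e.
  by have := hm0 m (leq_maxl _ _); rewrite ger0_norm// ltr_pdivlMr// => /ltW.
have close x y : agree k x y -> `|pt T' x - pt T y| <= d.
  move=> xy; apply: le_trans (ler_distD (pt T x) _ _) _.
  have := pt_lip x r1 h1' h2' h1 h2; have := pt_agree h1 h2 r1 xy; lra.
have E := block_homotopy D0 Bf Bf' (agree_le kn ff') (leq_maxr m0 k : (k <= m)%N) l1 l2 fT1 fT2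
  close hv farP farQ.
have bl : block (pt T ones) (pt T target2) (pt T') v' zeros
    (chain f' m zeros ones) (chain f' m zeros target2) by rewrite E.
have [y [z yz]] := block_near D0
  (chain_hop zeros ones Bf' r01 h1' h2' fe1 fe2 rm)
  (chain_hop zeros target2 Bf' r01 h1' h2' fe1 fe2 rm) bl.
(* The prefix of [f] has value [T' ^ n v'] at [T'], so the tail [z - y] leaves only [T' ^ n] times
   the small defect of the crossing. *)
pose f'' i := if (i < n)%N then f i else (z (i - n)%N)%:R - (y (i - n)%N)%:R.
have Bf'' : calB R f''.
  split; first by rewrite /f'' n0; case: Bf.
  move=> i i0; rewrite /f''; case: ltnP => _; first by case: Bf => _; apply.
  by case: (z _); case: (y _); rewrite ?subrr ?subr0 ?sub0r; tauto.
exists f''; first by split => // i ni; rewrite /f'' ni.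
have val'' t (w : R) : `|t| < 1 -> \sum_(i < n) f i * t ^+ i = t ^+ n * w ->
    psum f'' t = - (t ^+ n * (val t y - val t z - w)).
  move=> t1 pw; rewrite (psum_split n (calB_le Bf''))//.
  rewrite (eq_bigr (fun i : 'I_n => f i * t ^+ i)) => [|i _]; last by rewrite /f'' ltn_ord.
  rewrite pw -mulrDr -mulrN; congr (_ * _).
  rewrite (_ : (fun k => f'' (n + k)%N) = fun i => (z i)%:R - (y i)%:R); last first.
    by apply/funext => i; rewrite /f'' ltnNge leq_addr/= addKn.
  by rewrite -val_diff//; ring.
have fin t w : `|t| <= r -> `|w| <= sector_cst (pt T ones) (pt T target2) * (2 * e) ->
    `|- (t ^+ n * w)| <= r ^+ n * (sector_cst (pt T ones) (pt T target2) * (2 * e)).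
  move=> tr hw; rewrite normrN normrM normrX; apply: ler_pM => //.
  by rewrite lerXn2r ?nnegrE.
split; [rewrite (val'' _ v'.1)//|rewrite (val'' _ v'.2)//]; apply: fin => //.
  by apply: le_trans yz; exact: (norm1_le (pt T' y - pt T' z - v')).
by apply: le_trans yz; exact: (norm2_le (pt T' y - pt T' z - v')).
Qed.

(** The bound on [r ^+ n] makes every improvement halve the values, always keeping the first [n]
    digits of [f]; compactness then gives an exact common zero. *)
Lemma calN_of_odd_block f T T' v v' k d n r :
    calB R f -> (0 < n)%N -> (k <= n)%N ->
    0 <= r < 1 -> `|T.1| <= r -> `|T.2| <= r -> `|T'.1| <= r -> `|T'.2| <= r ->
    T.1 != T.2 -> psum f T.1 = 0 -> psum f T.2 = 0 ->
    r ^+ k / (1 - r) <= d / 2 -> `|T' - T| / (1 - r) ^+ 2 <= d / 2 -> `|v' - v| <= d ->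
    odd_block f T v k ->
    (forall o x, o = zeros \/ o = target2 -> far T d < `|pt T x - (pt T o + v)|) ->
    (forall o x, o = zeros \/ o = ones -> far T d < `|pt T o - v - pt T x|) ->
    \sum_(i < n) f i * T'.1 ^+ i = T'.1 ^+ n * v'.1 ->
    \sum_(i < n) f i * T'.2 ^+ i = T'.2 ^+ n * v'.2 ->
    r ^+ n * (sector_cst (pt T ones) (pt T target2) * 2) <= 2^-1 ->
  calN R T'.
Proof.
move=> Bf n0 kn r01 h1 h2 h1' h2' n12 fT1 fT2 hk hT hv odd farP farQ p1 p2 small.
have [r0 r1] := andP r01.
have C0 : 0 < (1 - r)^-1 by rewrite invr_gt0 subr_gt0.
have iter j : exists2 f', calB R f' /\ agree n f f' &
    `|psum f' T'.1| <= (1 - r)^-1 * 2^-1 ^+ j /\ `|psum f' T'.2| <= (1 - r)^-1 * 2^-1 ^+ j.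
  elim: j => [|j [f' [Bf' ff'] [e1 e2]]].
    exists f; first by split.
    have le t : `|t| <= r -> `|psum f t| <= (1 - r)^-1 * 2^-1 ^+ 0.
      move=> tr; rewrite expr0 mulr1; apply: le_trans (psum_le (calB_le Bf) (le_lt_trans tr r1)) _.
      by rewrite div1r lef_pV2 ?posrE; lra.
    by split; apply: le.
  have e0 : 0 < (1 - r)^-1 * 2^-1 ^+ j by rewrite mulr_gt0// exprn_gt0// invr_gt0.
  have [f'' Bf'' [s1 s2]] := crossing_improves Bf Bf' ff' n0 kn r01 h1 h2 h1' h2' n12 fT1 fT2 hk hT
    hv odd farP farQ p1 p2 e0 e1 e2.
  exists f'' => //; set e := (_ * _ ^+ j) in s1 s2 e0.
  have se : r ^+ n * (sector_cst (pt T ones) (pt T target2) * (2 * e)) <= (1 - r)^-1 * 2^-1 ^+ j.+1.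
    have -> : (1 - r)^-1 * 2^-1 ^+ j.+1 = 2^-1 * e by rewrite exprS mulrCA.
    rewrite (_ : _ * (_ * (2 * e)) = r ^+ n * (sector_cst (pt T ones) (pt T target2) * 2) * e).
      by rewrite ler_pM2r.
    by rewrite !mulrA.
  by split; [apply: le_trans s1 se|apply: le_trans s2 se].
rewrite (surjective_pairing T'); apply: calB_zero_of_small.
- exact: le_lt_trans r1.
- exact: le_lt_trans r1.
move=> e e0.
have [||j hj] := @expr_small _ (2^-1 : R) (e / (1 - r)^-1).
- by rewrite ger0_norm; lra.
- by rewrite divr_gt0.
have {}hj := hj j (leqnn _).
have ej : (1 - r)^-1 * 2^-1 ^+ j <= e.
  by move: hj; rewrite ger0_norm; [rewrite ltr_pdivlMr// mulrC => /ltW|lra].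
have [f' [Bf' _] [e1 e2]] := iter j.
by exists f' => //; split; [apply: le_trans e1 ej|apply: le_trans e2 ej].
Qed.

End ClosureInterior.

Section ClaimA.
Variable R : realType.
Implicit Types (f : nat -> R) (t r e d w : R) (T v : R * R).

Definition trunc f n t : R := \sum_(i < n) f i * t ^+ i.

Lemma trunc_sub_continuous f n w : continuous (fun t => trunc f n t - w * t ^+ n).
Proof.
have -> : (fun t => trunc f n t - w * t ^+ n) =
    horner (\poly_(i < n) f i - w *: 'X^n).
  by apply/funext => t; rewrite hornerD hornerN hornerZ hornerXn horner_poly.
exact: continuous_horner.
Qed.

Lemma IVT_zero (G : R -> R) a b : continuous G -> G a < 0 -> 0 < G b ->
  exists2 c, Num.min a b <= c <= Num.max a b & G c = 0.
Proof.
move=> cG Ga Gb.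
have H (x y : R) : x <= y -> Num.min (G x) (G y) <= 0 <= Num.max (G x) (G y) ->
    exists2 c, x <= c <= y & G c = 0.
  move=> xy h; have [|c] := IVT xy _ h; first exact: continuous_subspaceT.
  by rewrite in_itv; exists c.
have [ab|/ltW ba] := leP a b; apply: H => //.
  by rewrite ge_min le_max (ltW Ga) (ltW Gb) orbT.
by rewrite ge_min le_max (ltW Ga) (ltW Gb) orbT.
Qed.

(** For large [n] the polynomial [trunc f n t - w * t ^+ n] is uniformly close to [psum f] near [t0]
    and inherits both signs. A zero [s] of it solves the rescaled equation exactly, and continuity
    gives the neighbourhood. *)
Lemma local_solution f (t0 w r eta d : R) : calB R f -> 0 <= r < 1 -> 0 < eta -> 0 < d ->
    (forall t, `|t - t0| < eta -> `|t| <= r /\ t != 0) -> sign_change (psum f) t0 ->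
  exists N, forall n, (N <= n)%N -> exists2 s, `|s - t0| < eta &
    exists2 e : R, 0 < e & forall t, `|t - s| < e ->
      `|t - t0| < eta /\ `|trunc f n t / t ^+ n - w| <= d.
Proof.
move=> Bf /andP[r0 r1] eta0 d0 dom sc.
have [[a at0 Fa] [b bt0 Fb]] := sc eta eta0.
pose C := (1 - r)^-1 + `|w|.
have C0 : 0 < C by rewrite ltr_wpDr// invr_gt0 subr_gt0.
pose q := Num.min (- psum f a) (psum f b).
have q0 : 0 < q by rewrite lt_min oppr_gt0 Fa.
have [||N hN] := @expr_small _ r (q / C); [by rewrite ger0_norm|by rewrite divr_gt0|].
exists N => n Nn; pose G t := trunc f n t - w * t ^+ n.
have near t : `|t - t0| < eta -> `|psum f t - G t| < q.
  move=> /dom[tr _]; have t1 := le_lt_trans tr r1.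
  rewrite (psum_split n (calB_le Bf))// /G /trunc.
  set S := \sum_(i < n) _; set u := psum _ t.
  rewrite (_ : S + t ^+ n * u - (S - w * t ^+ n) = t ^+ n * (u + w)); last by ring.
  have := hN n Nn; rewrite ger0_norm// ltr_pdivlMr//; apply: le_lt_trans.
  rewrite normrM normrX; apply: ler_pM => //.
    by rewrite lerXn2r ?nnegrE.
  apply: le_trans (ler_normD _ _) _; rewrite lerD2r.
  apply: le_trans (psum_le (coef_le_shift n (calB_le Bf)) t1) _.
  by rewrite div1r lef_pV2 ?posrE; lra.
have qa : q <= - psum f a by rewrite ge_min lexx.
have qb : q <= psum f b by rewrite ge_min lexx orbT.
have Ga : G a < 0 by have := near a at0; rewrite ltr_norml => /andP[]; lra.
have Gb : 0 < G b by have := near b bt0; rewrite ltr_norml => /andP[]; lra.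
have [s /andP[s1 s2] Gs] := IVT_zero (@trunc_sub_continuous f n w) Ga Gb.
have st0 : `|s - t0| < eta.
  move: at0 bt0 s1 s2; rewrite !ltr_norml ge_min le_max => /andP[? ?] /andP[? ?].
  by move=> /orP[] ? /orP[] ?; apply/andP; split; lra.
exists s => //.
have [sr s0] := dom s st0.
have sn0 : s ^+ n != 0 by rewrite expf_neq0.
have cont : {for s, continuous (fun t => trunc f n t / t ^+ n)}.
  apply: cvgM.
    have := @trunc_sub_continuous f n 0 s; rewrite /continuous_at.
    by under eq_fun do rewrite mul0r subr0; rewrite mul0r subr0.
  by apply: cvgV => //; exact: exprn_continuous.
have val_s : trunc f n s / s ^+ n = w.
  by move/eqP: Gs; rewrite subr_eq0 => /eqP ->; rewrite mulfK.
have /cvgrPdist_le/(_ d d0)/nbhs_ballP[e e0 he] := cont.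
exists (Num.min e (eta - `|s - t0|)) => [|t]; first by rewrite lt_min e0 subr_gt0.
rewrite lt_min => /andP[ts1 ts2]; split.
  have := ler_normD (t - s) (s - t0).
  by rewrite (_ : t - s + (s - t0) = t - t0); [lra|ring].
rewrite distrC -val_s; apply: he.
by rewrite /ball /= distrC.
Qed.

(* A neighbourhood of a pair at which some series changes sign meets the
   interior: the truncations, rescaled by [t ^+ n], sweep out large intervals,
   so both coordinates of an odd block can be reached. *)
Lemma sign_changes_closure f (g l : R) : calB R f -> `|g| < 1 -> `|l| < 1 -> g != l ->
    `|g * l| < 2^-1 -> psum f g = 0 -> psum f l = 0 ->
    sign_change (psum f) g -> sign_change (psum f) l ->
  closure (interior (calN R)) (g, l).
Proof.
have le4 (a b c d : nat) : [/\ (a <= (a + b + c + d).+1)%N, (b <= (a + b + c + d).+1)%N,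
    (c <= (a + b + c + d).+1)%N & (d <= (a + b + c + d).+1)%N] by split; lia.
move=> Bf g1 l1 gl half fg fl sg sl A /nbhs_pair_ball[e e0 eA].
have g0 := calB_zero_neq0 Bf g1 fg; have l0 := calB_zero_neq0 Bf l1 fl.
pose M := Num.max `|g| `|l|.
have gM : `|g| <= M by rewrite le_max lexx.
have lM : `|l| <= M by rewrite le_max lexx orbT.
have M1 : M < 1 by rewrite gt_max g1.
pose r := (1 + M) / 2.
have r1 : r < 1 by rewrite /r; lra.
have Mr : M < r by rewrite /r; lra.
have r0 : 0 <= r by have := normr_ge0 g; lra.
have r01 : 0 <= r < 1 by rewrite r0.
have gr : `|g| <= r by lra.
have lr : `|l| <= r by lra.
have [v [k [d [d0 hk odd [farP farQ]]]]] :=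
  @odd_block_exists R f (g, l) r Bf gr lr r01 g0 l0 gl half.
set K := sector_cst _ _ in farP farQ.
have K0 : 0 <= K := sector_cst_ge0 _ _.
have K1 : 0 < K * 2 + 1 by move: K0; lra.
have q0 : 0 < (1 - r) ^+ 2 by rewrite exprn_gt0// subr_gt0.
(* The bounds keep the new pair in the given neighbourhood, within radius [r], away from zero, and
   within the tolerance of the homotopy. *)
pose eta := Num.min (Num.min e (r - M)) (Num.min (Num.min `|g| `|l|) (d / 2 * (1 - r) ^+ 2)).
have eta0 : 0 < eta.
  have d2 : 0 < d / 2 * (1 - r) ^+ 2 by rewrite mulr_gt0// divr_gt0.
  by rewrite !lt_min e0 subr_gt0 Mr !normr_gt0 g0 l0 d2.
have [eta_e eta_r eta_g [eta_l eta_d]] :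
    [/\ eta <= e, eta <= r - M, eta <= `|g| & eta <= `|l| /\ eta <= d / 2 * (1 - r) ^+ 2].
  by rewrite /eta !ge_min !lexx !orbT.
have dom t0 : `|t0| <= M -> eta <= `|t0| -> forall t, `|t - t0| < eta -> `|t| <= r /\ t != 0.
  move=> h1 h2 t ht; split.
    by have := ler_normD (t - t0) t0; rewrite subrK; lra.
  by apply: contraTneq ht => ->; rewrite sub0r normrN -leNgt.
have [N1 hN1] := local_solution v.1 Bf r01 eta0 d0 (dom g gM eta_g) sg.
have [N2 hN2] := local_solution v.2 Bf r01 eta0 d0 (dom l lM eta_l) sl.
have [||N3 hN3] := @expr_small _ r (2^-1 / (K * 2 + 1)).
- by rewrite ger0_norm.
- by rewrite divr_gt0.
pose n := (N1 + N2 + N3 + k).+1.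
have [nN1 nN2 nN3 nk] : [/\ (N1 <= n)%N, (N2 <= n)%N, (N3 <= n)%N & (k <= n)%N] := le4 _ _ _ _.
have [x xg [e1 e10 he1]] := hN1 n nN1.
have [y yl [e2 e20 he2]] := hN2 n nN2.
have small : r ^+ n * (K * 2) <= 2^-1.
  have := hN3 n nN3; rewrite ger0_norm// ltr_pdivlMr// => /ltW.
  by apply: le_trans; rewrite ler_wpM2l ?exprn_ge0// lerDl.
exists (x, y); split; last first.
  by apply: eA => /=; rewrite distrC; [apply: lt_le_trans xg _|apply: lt_le_trans yl _].
apply/nbhs_pair_ball; exists (Num.min e1 e2) => [|[t u] /= ht hu]; first by rewrite lt_min e10.
have [|tg tv] := he1 t; first by move: ht; rewrite lt_min distrC => /andP[].
have [|ul uv] := he2 u; first by move: hu; rewrite lt_min distrC => /andP[].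
have [tr t0] := dom g gM eta_g t tg; have [ur u0] := dom l lM eta_l u ul.
apply: (@calN_of_odd_block R f (g, l) (t, u) v (trunc f n t / t ^+ n, trunc f n u / u ^+ n) k d n r) => //.
- rewrite ler_pdivrMr//; apply: le_trans eta_d.
  by apply: norm_le_pair; apply: ltW.
- exact: norm_le_pair.
- by rewrite /= mulrC divfK// expf_neq0.
- by rewrite /= mulrC divfK// expf_neq0.
Qed.

End ClaimA.

(** * Rigidity of extremal tails *)

Section Isolation.
Variable R : realType.
Implicit Types (f b c : nat -> R) (t x y z r e d s : R).

Lemma calB_sign_zero f x y : calB R f -> `|x| < 1 -> `|y| < 1 ->
    psum f x < 0 -> 0 < psum f y ->
  exists2 z, Num.min x y <= z <= Num.max x y & psum f z = 0 /\ sign_change (psum f) z.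
Proof.
move=> Bf x1 y1 fx fy.
have inside (p q z : R) : `|p| < 1 -> `|q| < 1 -> p <= z <= q -> `|z| < 1.
  by rewrite !ltr_norml => /andP[? ?] /andP[? ?] /andP[? ?]; apply/andP; split; lra.
have ff : psum f x < psum f y := lt_trans fx fy.
have [xy|yx|xy] := ltgtP x y; last by move: ff; rewrite xy ltxx.
  apply: (sign_change_zero xy fx fy) => z hz.
    exact: psum_continuous (calB_le Bf) (inside _ _ _ x1 y1 hz).
  exact: calB_zeros_isolated Bf (inside _ _ _ x1 y1 hz).
have [|||z hz|z hz [Fz Sz]] := @sign_change_zero R (fun t => - psum f t) y x yx.
- by rewrite oppr_lt0.
- by rewrite oppr_gt0.
- move=> z hz; apply: cvgN.
  exact: psum_continuous (calB_le Bf) (inside _ _ _ y1 x1 hz).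
- move=> /eqP; rewrite oppr_eq0 => /eqP fz.
  have [e e0 he] := calB_zeros_isolated Bf (inside _ _ _ y1 x1 hz) fz.
  by exists e => // t /he; rewrite oppr_eq0.
exists z => //; split; first by apply/eqP; rewrite -oppr_eq0 Fz.
have := sign_changeN Sz; congr sign_change.
by apply/funext => t; rewrite opprK.
Qed.

Definition set_digit f n (c : R) : nat -> R := fun i => if i == n then c else f i.

Lemma calB_set_digit f n (c : R) : calB R f -> (0 < n)%N -> c = -1 \/ c = 0 \/ c = 1 ->
  calB R (set_digit f n c).
Proof.
move=> [f0 fS] n0 hc; split; first by rewrite /set_digit ltn_eqF.
by move=> i i0; rewrite /set_digit; case: eqP => // _; exact: fS.
Qed.

Lemma digit_norm_le (c : R) : c = -1 \/ c = 0 \/ c = 1 -> `|c| <= 1.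
Proof. by case=> [->|[->|->]]; rewrite ?normrN ?normr1 ?normr0. Qed.

Lemma psum_set_digit f n (c : R) x : calB R f -> (0 < n)%N -> c = -1 \/ c = 0 \/ c = 1 ->
  `|x| < 1 -> psum (set_digit f n c) x = psum f x + (c - f n) * x ^+ n.
Proof.
move=> Bf n0 hc x1; have Bg := calB_set_digit Bf n0 hc.
rewrite (psum_split n.+1 (calB_le Bg) x1) (psum_split n.+1 (calB_le Bf) x1).
rewrite !big_ord_recr /= {2}/set_digit eqxx.
have -> : \sum_(i < n) set_digit f n c i * x ^+ i = \sum_(i < n) f i * x ^+ i.
  by apply: eq_bigr => i _; rewrite /set_digit ltn_eqF.
have -> : (fun k => set_digit f n c (n.+1 + k)%N) = (fun k => f (n.+1 + k)%N).
  by apply/funext => k; rewrite /set_digit gtn_eqF// ltn_addr.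
by ring.
Qed.

(** Changing the digit at [n] cannot lower [s] times the value at [t]. *)
Definition extremal f s t n := forall c : R, c = -1 \/ c = 0 \/ c = 1 ->
  0 <= s * (c - f n) * t ^+ n.

(* If the tail of [f] is not extremal at [t], moving one far digit pushes [f]
   through zero at [t], which creates a sign change there. *)
Lemma not_extremal_perturb f t u s : calB R f -> `|t| < 1 -> `|u| < 1 ->
    psum f t = 0 -> s = 1 \/ s = -1 ->
    (exists2 e : R, 0 < e & forall x, `|x - t| < e -> 0 <= s * psum f x) ->
    sign_change (psum f) u ->
    (forall n0, exists2 n, (n0 <= n)%N & ~ extremal f s t n) ->
  forall eta : R, 0 < eta -> exists f' z w, [/\ calB R f',
    `|z - t| < eta /\ `|w - u| < eta,
    psum f' z = 0 /\ sign_change (psum f') z &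
    psum f' w = 0 /\ sign_change (psum f') w].
Proof.
move=> Bf t1 u1 ft hs [e e0 he] sc next eta0 eta00.
pose M := Num.max `|t| `|u|.
have tM : `|t| <= M by rewrite le_max lexx.
have uM : `|u| <= M by rewrite le_max lexx orbT.
have M1 : M < 1 by rewrite gt_max t1.
pose r := (1 + M) / 2.
have r1 : r < 1 by rewrite /r; lra.
have Mr : M < r by rewrite /r; lra.
have r0 : 0 <= r by have := normr_ge0 t; lra.
pose eta := Num.min eta0 (r - M).
have eta_0 : 0 < eta by rewrite lt_min eta00 subr_gt0.
have eta_le : eta <= eta0 by rewrite ge_min lexx.
have eta_r : eta <= r - M by rewrite ge_min lexx orbT.
clearbody eta.
have bound (p q : R) : `|p| <= M -> `|q - p| < eta -> `|q| <= r.
  by move=> h1 h2; have := ler_normD (q - p) p; rewrite subrK; lra.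
have [i i0 hi] := calB_zeros_isolated Bf t1 ft.
(* Zeros are isolated, so the weak sign of [f] is strict at this point. *)
pose x := t + Num.min (Num.min e i) eta / 2.
have m0 : 0 < Num.min (Num.min e i) eta by rewrite !lt_min e0 i0 eta_0.
have [m1 m2 m3] : [/\ Num.min (Num.min e i) eta <= e, Num.min (Num.min e i) eta <= i &
    Num.min (Num.min e i) eta <= eta] by rewrite !ge_min !lexx !orbT.
have xt : `|x - t| = Num.min (Num.min e i) eta / 2.
  by rewrite /x addrAC subrr add0r gtr0_norm// divr_gt0.
have fx : 0 < s * psum f x.
  rewrite lt_neqAle he; last by rewrite xt; lra.
  rewrite andbT eq_sym mulf_neq0//; last by apply: hi; rewrite xt; lra.
  by case: hs => ->; rewrite ?oner_neq0// oppr_eq0 oner_neq0.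
have [[y1 y1u fy1] [y2 y2u fy2]] := sc eta eta_0.
(* A change of a far digit alters the values by less than [q], so the signs at [x], [y1] and [y2]
   survive, while at [t], where [f] vanishes, the opposite sign appears. *)
pose q := Num.min (s * psum f x) (Num.min (- psum f y1) (psum f y2)).
have q0 : 0 < q by rewrite !lt_min fx oppr_gt0 fy1.
have [q1 q2 q3] : [/\ q <= s * psum f x, q <= - psum f y1 & q <= psum f y2].
  by rewrite /q !ge_min !lexx !orbT.
have [||N hN] := @expr_small _ r (q / 2).
- by rewrite ger0_norm.
- by rewrite divr_gt0.
have [n nN] := next N.+1; move=> /existsNP[c /not_implyP[hc /negP]].
rewrite -ltNge => neg.
have n0 : (0 < n)%N by exact: leq_trans nN.
have Bg := calB_set_digit Bf n0 hc.
pose f' := set_digit f n c.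
have fE (p : R) : `|p| <= r -> psum f' p = psum f p + (c - f n) * p ^+ n.
  by move=> pr; apply: psum_set_digit => //; exact: le_lt_trans r1.
have small (p : R) : `|p| <= r -> `|(c - f n) * p ^+ n| < q.
  move=> pr; rewrite normrM normrX.
  have := hN n (ltnW nN); rewrite (ger0_norm r0) => h.
  have h1 : `|p| ^+ n <= r ^+ n by rewrite lerXn2r ?nnegrE.
  have h2 : `|c - f n| <= 2.
    have := ler_normB c (f n); have := digit_norm_le hc; have := calB_le Bf n; lra.
  have h3 : `|c - f n| * `|p| ^+ n <= 2 * r ^+ n by apply: ler_pM.
  lra.
have s1 : `|s| = 1 by case: hs => ->; rewrite ?normrN normr1.
have xr : `|x| <= r by apply: (bound t) => //; rewrite xt; lra.
have tr : `|t| <= r by lra.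
have y1r : `|y1| <= r by exact: (bound u).
have y2r : `|y2| <= r by exact: (bound u).
have gt : s * psum f' t < 0 by rewrite fE// ft add0r mulrA.
have gx : 0 < s * psum f' x.
  have h : `|s * ((c - f n) * x ^+ n)| < q by rewrite normrM s1 mul1r small.
  by rewrite fE// mulrDr; move: h; rewrite ltr_norml => /andP[]; lra.
have gy1 : psum f' y1 < 0.
  by rewrite fE//; have := small y1 y1r; rewrite ltr_norml => /andP[]; lra.
have gy2 : 0 < psum f' y2.
  by rewrite fE//; have := small y2 y2r; rewrite ltr_norml => /andP[]; lra.
have lt1 (p : R) : `|p| <= r -> `|p| < 1 by move=> h; exact: le_lt_trans r1.
have between (p q' o z : R) : `|p - o| < eta -> `|q' - o| < eta ->
    Num.min p q' <= z <= Num.max p q' -> `|z - o| < eta0.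
  rewrite ge_min le_max !ltr_norml => /andP[? ?] /andP[? ?].
  by move=> /andP[/orP[] ? /orP[] ?]; apply/andP; split; lra.
have [w hw Zw] := calB_sign_zero Bg (lt1 _ y1r) (lt1 _ y2r) gy1 gy2.
have tt : `|t - t| < eta by rewrite subrr normr0.
have xt' : `|x - t| < eta by rewrite xt; lra.
have [z hz Zz] : exists2 z, `|z - t| < eta0 & psum f' z = 0 /\ sign_change (psum f') z.
  case: hs gt gx => -> ; rewrite ?mul1r ?mulN1r ?oppr_lt0 ?oppr_gt0 => gt gx.
    have [z hz Zz] := calB_sign_zero Bg (lt1 _ tr) (lt1 _ xr) gt gx.
    by exists z => //; exact: between tt xt' hz.
  have [z hz Zz] := calB_sign_zero Bg (lt1 _ xr) (lt1 _ tr) gx gt.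
  by exists z => //; exact: between xt' tt hz.
exists f', z, w; split => //; split => //.
exact: between y1u y2u hw.
Qed.

(** Distinct coordinates and a product below one half are open conditions, so nearby pairs with two
    sign changes are in the closure of the interior; so is their limit. *)
Lemma closure_of_perturb (g l : R) : `|g| < 1 -> `|l| < 1 -> g != l -> `|g * l| < 2^-1 ->
    (forall eta : R, 0 < eta -> exists f' z w, [/\ calB R f',
      `|z - g| < eta /\ `|w - l| < eta,
      psum f' z = 0 /\ sign_change (psum f') z &
      psum f' w = 0 /\ sign_change (psum f') w]) ->
  closure (interior (calN R)) (g, l).
Proof.
move=> g1 l1 gl half hp A /nbhs_pair_ball[e e0 /= eA].
have gl0 : 0 < `|g - l| by rewrite normr_gt0 subr_eq0.
pose eta := Num.min (Num.min (e / 2) ((1 - `|g|) / 2)) (Num.min (Num.min ((1 - `|l|) / 2)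
  (`|g - l| / 3)) ((2^-1 - `|g * l|) / 4)).
have eta0 : 0 < eta.
  by rewrite /eta !lt_min !divr_gt0// subr_gt0.
have [a1 a2 a3] : [/\ eta <= e / 2, eta <= (1 - `|g|) / 2 & eta <= (1 - `|l|) / 2].
  by rewrite /eta !ge_min !lexx !orbT.
have [a4 a5] : eta <= `|g - l| / 3 /\ eta <= (2^-1 - `|g * l|) / 4.
  by rewrite /eta !ge_min !lexx !orbT.
clearbody eta.
have [f [z [w [Bf [zg wl] [fz sz] [fw sw]]]]] := hp eta eta0.
have z1 : `|z| < 1 by have := ler_normD (z - g) g; rewrite subrK; lra.
have w1 : `|w| < 1 by have := ler_normD (w - l) l; rewrite subrK; lra.
have zw : z != w.
  apply: contraTneq zg => zw; rewrite -leNgt.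
  have := ler_normD (g - z) (z - l); rewrite addrA subrK (distrC g z) zw => h.
  by move: wl; lra.
have half' : `|z * w| < 2^-1.
  have -> : z * w = g * l + (z - g) * w + g * (w - l) by ring.
  have h1 := ler_normD (g * l + (z - g) * w) (g * (w - l)).
  have h2 := ler_normD (g * l) ((z - g) * w).
  have h3 : `|(z - g) * w| <= eta by rewrite normrM -[leRHS]mulr1; apply: ler_pM => //; exact: ltW.
  have h4 : `|g * (w - l)| <= eta by rewrite normrM -[leRHS]mul1r; apply: ler_pM => //; exact: ltW.
  lra.
apply: (sign_changes_closure Bf z1 w1 zw half' fz fw sz sw).
apply/nbhs_pair_ball; exists (e / 2) => [|Q /= h1 h2]; first by rewrite divr_gt0.
apply: eA.
  by have := ler_normD (g - z) (z - Q.1); rewrite addrA subrK (distrC g z); lra.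
by have := ler_normD (l - w) (w - Q.2); rewrite addrA subrK (distrC l w); lra.
Qed.

Lemma psum_terms_eq0 c x M : coef_le M c -> `|x| < 1 -> (forall n, 0 <= c n * x ^+ n) ->
  psum c x <= 0 -> forall n, c n * x ^+ n = 0.
Proof.
move=> cM x1 c0 px n; apply/le_anti; rewrite c0 andbT.
apply: le_trans px; apply: le_trans (_ : pseries c x n.+1 <= _).
  by rewrite /pseries /series /= big_nat_recr//= lerDr sumr_ge0.
apply: nondecreasing_cvgn_le; last exact: psum_is_cvg cM x1.
by apply: (@nondecreasing_series _ (fun n => c n * x ^+ n) xpredT 0%N) => k _ _; exact: c0.
Qed.

(* With an extremal tail, every series agreeing with [f] on the initial digits
   lies on one side of it near [t]. *)
Lemma extremal_rigid f b t x s n0 : calB R f -> calB R b -> s = 1 \/ s = -1 ->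
    (forall n, (n0 <= n)%N -> extremal f s t n) -> agree n0 f b ->
    `|x| < 1 -> 0 < t * x -> 0 <= s * psum f x -> psum b x = 0 ->
  b = f.
Proof.
move=> Bf Bb hs ext fb x1 tx fx bx.
have tn0 : t != 0 by apply: contraTneq tx => ->; rewrite mul0r ltxx.
have xn0 : x != 0 by apply: contraTneq tx => ->; rewrite mulr0 ltxx.
have s0 : s != 0 by case: hs => ->; rewrite ?oppr_eq0 oner_neq0.
have dM : coef_le 2 (fun n => b n - f n).
  move=> n; have := ler_normB (b n) (f n).
  by have := calB_le Bb n; have := calB_le Bf n; lra.
have sM : coef_le (`|s| * 2) (fun n => s * (b n - f n)).
  by move=> n; rewrite normrM ler_wpM2l.
have terms n : 0 <= s * (b n - f n) * x ^+ n.
  have [nn0|nn0] := ltnP n n0; first by rewrite fb// subrr mulr0 mul0r.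
  have := ext n nn0 (b n) (calB_digit n Bb).
  have tn : 0 < t ^+ n * x ^+ n by rewrite -exprMn exprn_gt0.
  have t2 : 0 < (t ^+ n) ^+ 2 by rewrite lt_neqAle sqr_ge0 eq_sym !expf_neq0.
  move=> h; rewrite -(pmulr_lge0 _ t2).
  have -> : s * (b n - f n) * x ^+ n * (t ^+ n) ^+ 2 =
    s * (b n - f n) * t ^+ n * (t ^+ n * x ^+ n) by ring.
  by rewrite mulr_ge0// ltW.
have px : psum (fun n => s * (b n - f n)) x <= 0.
  rewrite (psumZ s dM x1) (psumB (calB_le Bb) (calB_le Bf) x1) bx sub0r mulrN.
  by rewrite oppr_le0.
apply/funext => n; have /eqP := psum_terms_eq0 sM x1 terms px n.
rewrite !mulf_eq0 (negPf s0) expf_eq0 (negPf xn0) andbF orbF /= subr_eq0.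
by move/eqP.
Qed.

Lemma limit_zero f t : calB R f -> `|t| < 1 ->
    (forall n e, 0 < e -> exists2 b, calB R b /\ agree n f b &
      exists2 x, `|x - t| < e /\ `|x| < 1 & psum b x = 0) ->
  psum f t = 0.
Proof.
move=> Bf t1 app; apply/eqP; rewrite -normr_le0; apply: le0_of_small => e e0.
pose r := (1 + `|t|) / 2.
have r1 : r < 1 by rewrite /r; lra.
have tr : `|t| < r by rewrite /r; lra.
have r0 : 0 <= r by have := normr_ge0 t; lra.
have e2 : 0 < e / 2 by rewrite divr_gt0.
have /cvgrPdist_le/(_ _ e2)/nbhs_ballP[d d0 hd] := psum_continuous (calB_le Bf) t1.
have C0 : 0 < (1 + 1) / (1 - r) by rewrite divr_gt0// subr_gt0.
have [||n hn] := @expr_small _ r (e / 2 / ((1 + 1) / (1 - r))).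
- by rewrite ger0_norm.
- by rewrite divr_gt0.
have d'0 : 0 < Num.min d (r - `|t|) by rewrite lt_min d0 subr_gt0.
have [b [Bb fb] [x [xt x1] bx]] := app n _ d'0.
move: xt; rewrite lt_min => /andP[xt1 xt2].
have xr : `|x| <= r by have := ler_normD (x - t) t; rewrite subrK; lra.
have h1 : `|psum f t - psum f x| <= e / 2.
  by apply: hd; rewrite /ball /= distrC.
have h2 := psum_agree (calB_le Bf) (calB_le Bb) x1 fb.
rewrite bx subr0 in h2.
have h3 : `|x| ^+ n * ((1 + 1) / (1 - `|x|)) <= r ^+ n * ((1 + 1) / (1 - r)).
  apply: ler_pM => //; first by rewrite divr_ge0// subr_ge0 ltW.
    by rewrite lerXn2r ?nnegrE.
  by rewrite ler_pM2l// lef_pV2 ?posrE; lra.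
have h4 : r ^+ n * ((1 + 1) / (1 - r)) < e / 2.
  by have := hn n (leqnn _); rewrite ger0_norm// ltr_pdivlMr.
have := ler_normD (psum f t - psum f x) (psum f x); rewrite subrK.
by have := le_lt_trans (le_trans h2 h3) h4; lra.
Qed.

End Isolation.

Section MixedCase.
Variable R : realType.
Implicit Types (f b : nat -> R) (t u x y e : R).

(** If the tail were extremal from some index on, rigidity would identify a close approximating
    series with [f]. Its pair of zeros would then be near [(t, u)] but different from it, against
    isolation of the zeros of [f]. *)
Lemma limit_of_zeros_sign_change f t u : calB R f -> `|t| < 1 -> `|u| < 1 ->
    psum f t = 0 -> psum f u = 0 -> sign_change (psum f) u ->
    (forall n e, 0 < e -> exists2 b, calB R b /\ agree n f b &
      exists x y, [/\ (x, y) <> (t, u), `|x - t| < e, `|y - u| < e,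
        psum b x = 0 & psum b y = 0]) ->
    ~ sign_change (psum f) t ->
  forall eta : R, 0 < eta -> exists f' z w, [/\ calB R f',
    `|z - t| < eta /\ `|w - u| < eta,
    psum f' z = 0 /\ sign_change (psum f') z &
    psum f' w = 0 /\ sign_change (psum f') w].
Proof.
move=> Bf t1 u1 ft fu su app /not_sign_change[s [hs [e e0 he]]].
apply: (not_extremal_perturb Bf t1 u1 ft hs _ su); first by exists e.
move=> n0; apply: contrapT => hno.
have ext n : (n0 <= n)%N -> extremal f s t n.
  by move=> nn; apply: contrapT => h; apply: hno; exists n.
have t0 : 0 < `|t| by rewrite normr_gt0 (calB_zero_neq0 Bf).
have [i i0 hi] := calB_zeros_isolated Bf t1 ft.
have [j j0 hj] := calB_zeros_isolated Bf u1 fu.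
pose d := Num.min (Num.min e i) (Num.min (Num.min `|t| (1 - `|t|)) j).
have d0 : 0 < d by rewrite !lt_min e0 i0 t0 subr_gt0 t1 j0.
have [d1 d2 d3] : [/\ d <= e, d <= i & d <= `|t|] by rewrite /d !ge_min !lexx !orbT.
have [d4 d5] : d <= 1 - `|t| /\ d <= j by rewrite /d !ge_min !lexx !orbT.
clearbody d.
have [b [Bb fb] [x [y [ne xt yu bx byy]]]] := app n0 d d0.
have x1 : `|x| < 1 by have := ler_normD (x - t) t; rewrite subrK; lra.
have tx : 0 < t * x.
  rewrite (_ : t * x = `|t| ^+ 2 + t * (x - t)); last by rewrite real_normK ?num_real//; ring.
  have h : `|t * (x - t)| < `|t| ^+ 2.
    by rewrite normrM expr2 ltr_pM2l//; lra.
  by move: h; rewrite ltr_norml => /andP[]; lra.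
have fx : 0 <= s * psum f x by apply: he; lra.
have bf := extremal_rigid Bf Bb hs ext fb x1 tx fx bx.
apply: ne; congr (_, _); apply/eqP; rewrite -subr_eq0 -normr_eq0; apply: contraT => h.
  by have := hi x; rewrite lt_neqAle eq_sym h normr_ge0 -bf bx eqxx; apply; lra.
by have := hj y; rewrite lt_neqAle eq_sym h normr_ge0 -bf byy eqxx; apply; lra.
Qed.

End MixedCase.

(** * Isolation of outliers *)

Unset Implicit Arguments.

Theorem theorem6p5 (R : realType) (gamma lambda : R)
  (h : outlier R (gamma, lambda)) :
  exists U : set (R * R),
    [/\ open U, U (gamma, lambda) & U `&` calN R = [set (gamma, lambda)]].
Proof.
have half := outlier_prod_lt_half h.
case: h => -[Ngl nD] ncl.
have [/= g1 l1 _] := Ngl.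
have gl : gamma != lambda by apply/eqP => gl; apply: nD.
have {}g1 : `|gamma| < 1 by rewrite ltr_norml.
have {}l1 : `|lambda| < 1 by rewrite ltr_norml.
have [[e e0 iso]|noniso] := pselect (exists2 e : R, 0 < e & forall P, calN R P ->
    `|gamma - P.1| < e -> `|lambda - P.2| < e -> P = (gamma, lambda)).
  exists (interior (ball (gamma, lambda) e)); split.
  - exact: open_interior.
  - exact: nbhsx_ballx.
  - apply/seteqP; split => [P [/interior_subset[h1 h2] NP]|_ ->]; first exact: iso.
    by split => //; exact: nbhsx_ballx.
exfalso; apply: ncl.
(* Without isolation each [Q k] meets [calB]. Compactness yields one series [f] all of whose
   prefixes extend to series vanishing at pairs arbitrarily close to the given one but different
   from it. *)
pose Q k := [set b : nat -> R | exists x y, [/\ (x, y) <> (gamma, lambda),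
  `|x - gamma| < k.+1%:R^-1 /\ `|y - lambda| < k.+1%:R^-1, `|x| < 1 /\ `|y| < 1 &
  psum b x = 0 /\ psum b y = 0]].
have Qanti k b : Q k.+1 b -> Q k b.
  have le : (k.+2%:R^-1 : R) <= k.+1%:R^-1 by rewrite lef_pV2 ?posrE// ler_nat.
  move=> [x [y [ne [xg yl] xy1 bxy]]]; exists x, y; split => //.
  by split; [exact: lt_le_trans xg le|exact: lt_le_trans yl le].
have Qex k : exists2 b, calB R b & Q k b.
  apply: contrapT => hno; apply: noniso; exists k.+1%:R^-1; first by rewrite invr_gt0.
  move=> [x y] [/= x1 y1 [b Bb [bx byy]]] xg yl; apply: contrapT => ne; apply: hno.
  exists b => //; exists x, y; split => //; last by rewrite !ltr_norml.
  by rewrite distrC (distrC y).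
have [f Bf hf] := calB_konig Qanti Qex.
have app n (e : R) : 0 < e -> exists2 b, calB R b /\ agree n f b &
    exists x y, [/\ (x, y) <> (gamma, lambda), `|x - gamma| < e /\ `|y - lambda| < e,
      `|x| < 1 /\ `|y| < 1 & psum b x = 0 /\ psum b y = 0].
  move=> e0; have [b Bb [[x [y [ne [xg yl] xy1 bxy]]] fb]] := hf n (Num.truncn e^-1).
  have le : ((Num.truncn e^-1).+1%:R^-1 : R) <= e.
    by rewrite invf_ple ?posrE//; exact/ltW/truncnS_gt.
  exists b => //; exists x, y; split => //.
  by split; [exact: lt_le_trans xg le|exact: lt_le_trans yl le].
have fg : psum f gamma = 0.
  apply: limit_zero => // n e e0.
  have [b Bb [x [y [_ [xg _] [x1 _] [bx _]]]]] := app n e e0.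
  by exists b => //; exists x.
have fl : psum f lambda = 0.
  apply: limit_zero => // n e e0.
  have [b Bb [x [y [_ [_ yl] [_ y1] [_ byy]]]]] := app n e e0.
  by exists b => //; exists y.
(* Two sign changes suffice directly, one yields nearby series with two, and none contradicts
   Jensen's bound. *)
have [sg|ng] := pselect (sign_change (psum f) gamma);
  have [sl|nl] := pselect (sign_change (psum f) lambda).
- exact: sign_changes_closure Bf g1 l1 gl half fg fl sg sl.
- apply: closure_of_perturb => // eta eta0.
  have [|f' [z [w [Bf' [zl wg] sz sw]]]] :=
    limit_of_zeros_sign_change Bf l1 g1 fl fg sg _ nl eta0; last by exists f', w, z.
  move=> n e e0; have [b Bb [x [y [ne [xg yl] _ [bx byy]]]]] := app n e e0.
  by exists b => //; exists y, x; split => // -[yl' xg']; apply: ne; rewrite yl' xg'.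
- apply: closure_of_perturb => // eta eta0.
  apply: (limit_of_zeros_sign_change Bf g1 l1 fg fl sl _ ng eta0).
  move=> n e e0; have [b Bb [x [y [ne [xg yl] _ [bx byy]]]]] := app n e e0.
  by exists b => //; exists x, y.
- by have [] := calB_sign_change_or Bf g1 l1 gl half fg fl.
Qed.
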